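(* Let $g\geq 3$. Every Zariski dense discrete subgroup of $\mathrm{Sp}_g(\mathbb{R})$ which contains a finite index subgroup of $\mathrm{Sp}_{g-1}(\mathbb{Z})$ (with $\mathrm{Sp}_{g-1}<\mathrm{Sp}_g$ embedded in the top left hand corner) is commensurable to a conjugate of $\mathrm{Sp}_g(\mathbb{Z})$ in $\mathrm{Sp}_g(\mathbb{R})$.
   Context: $\mathrm{Sp}_g$ is the symplectic group of $2g\times 2g$ matrices preserving the non-degenerate symplectic form $J_g=\mathrm{diag}(J_2,\dots,J_2)$ ($g$ blocks) in $2g$ variables, where $J_2=\begin{pmatrix}0&1\\-1&0\end{pmatrix}$; $\mathrm{Sp}_g(\mathbb{Z})$ is the integral symplectic group. For $k\leq g$, the top left hand corner embedding $\mathrm{Sp}_k<\mathrm{Sp}_g$ sends a $2k\times 2k$ matrix $M$ to $\begin{pmatrix} M & 0\\ 0 & I_{2g-2k}\end{pmatrix}$. Two subgroups are commensurable (commensurate) if their intersection has finite index in each of them. *)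

(* Defs.v *)
(* The notations of multinomials are filtered out because some of them conflict
   with those of MathComp-Analysis. *)
From HB Require Import structures.
From mathcomp Require Import all_boot all_order all_algebra.
From mathcomp Require Import -(notations) mpoly.
From mathcomp Require Import boolp classical_sets functions cardinality.
From mathcomp Require Import reals topology.

Set Implicit Arguments.
Unset Strict Implicit.
Unset Printing Implicit Defensive.

Import GRing.Theory Num.Theory numFieldTopology.Exports.

Local Open Scope classical_set_scope.
Local Open Scope ring_scope.

(* J_g = diag(J_2, ..., J_2): the a-th block occupies rows and columns
   2a and 2a+1 (counting from 0). *)
Definition symp_form (R : pzRingType) (g : nat) : 'M[R]_(2 * g) :=
  \matrix_(i, j) (if (i %/ 2 == j %/ 2)%N then (i < j)%N%:R - (j < i)%N%:R
                  else 0).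

Definition Sp (R : comNzRingType) (g : nat) : set 'M[R]_(2 * g) :=
  [set A | A^T *m symp_form R g *m A = symp_form R g].
Arguments Sp : clear implicits.

(* Sp_g(Z), as a set of matrices with coefficients in R. *)
Definition SpZ (R : comNzRingType) (g : nat) : set 'M[R]_(2 * g) :=
  [set map_mx intr A | A in Sp int g].
Arguments SpZ : clear implicits.

Lemma sp_embed_dim (k g : nat) : (k <= g)%N -> (2 * k + (2 * g - 2 * k) = 2 * g)%N.
Proof. by move=> kg; rewrite subnKC // leq_mul2l. Qed.

(* The top left hand corner embedding; the cast is along
   2k + (2g - 2k) = 2g. *)
Definition sp_embed (R : pzRingType) (k g : nat) (kg : (k <= g)%N)
    (M : 'M[R]_(2 * k)) : 'M[R]_(2 * g) :=
  castmx (sp_embed_dim kg, sp_embed_dim kg)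
    (block_mx M 0 0 (1%:M : 'M[R]_(2 * g - 2 * k))).

Section MatrixGroups.
Variables (R : comUnitRingType) (n : nat).
Implicit Types G H : set 'M[R]_n.

(* Subgroups of GL_n(R).  The first clause matters since invmx A = A when A
   is not invertible. *)
Definition mx_subgroup H : Prop :=
  [/\ H `<=` [set A | A \in unitmx],
      H 1%:M,
      forall A B, H A -> H B -> H (A *m B)
    & forall A, H A -> H (invmx A)].

Definition finite_index H G : Prop :=
  H `<=` G /\ finite_set [set [set A *m B | B in H] | A in G].

Definition commensurable G H : Prop :=
  finite_index (G `&` H) G /\ finite_index (G `&` H) H.

Definition mx_conj (C : 'M[R]_n) G : set 'M[R]_n :=
  [set C *m A *m invmx C | A in G].

End MatrixGroups.

Section Zariski.
Variables (F : fieldType) (n : nat).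
Implicit Types X Y Z : set 'M[F]_n.

(* The n * n variables stand for the entries of an n x n matrix, listed in the
   order given by mxvec. *)
Definition mx_zero_locus (S : set (mpoly (n * n) F)) : set 'M[F]_n :=
  [set A | forall p, S p -> meval (fun k => mxvec A 0 k) p = 0].

Definition zariski_closed Z : Prop := exists S, Z = mx_zero_locus S.

Definition zariski_closure X : set 'M[F]_n :=
  [set A | forall Z, zariski_closed Z -> X `<=` Z -> Z A].

Definition zariski_dense_in X Y : Prop :=
  X `<=` Y /\ Y `<=` zariski_closure X.

End Zariski.

(* The subspace topology induced on X is discrete. *)
Definition discrete_subset (T : topologicalType) (X : set T) : Prop :=
  X `<=` isolated X.

(* Main.v *)
Require Import Defs.
From HB Require Import structures.
From mathcomp Require Import all_boot all_order all_algebra.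
From mathcomp Require Import -(notations) mpoly.
From mathcomp Require Import ring lra zify.
From mathcomp Require Import boolp classical_sets functions cardinality.
From mathcomp Require Import reals topology.

Set Implicit Arguments.
Unset Strict Implicit.
Unset Printing Implicit Defensive.

Import Order.TTheory GRing.Theory Num.Theory numFieldTopology.Exports.

Local Open Scope classical_set_scope.
Local Open Scope ring_scope.

(** Write [om] for the symplectic form, and split the space as the corner [W], of
    dimension [2 (g - 1) >= 4], plus the orthogonal plane [P].  The proof follows
    the vectors [u] whose transvection [tv s u : x |-> x + s om(u, x) u] lies in
    [Gamma], for a fixed coefficient [s].

    The only use of discreteness is an inequality of Shimizu type ([shimizu]): if
    [tv s u] and [tv s v] lie in [Gamma] then [om u v = 0] or [s |om u v| >= 1].
    Since a subgroup of finite index of [Sp_(g-1)(Z)] contains [tv N v] for every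
    integral [v] in [W] and one [N] ([finite_index_tv]), every vector [u] in the
    [Gamma]-orbit of such a [v] pairs with the integral vectors of [W] in a set
    that has a gap at [0], hence in a cyclic group.  So [u = c f + p] with [f]
    integral in [W] and [p] in [P] ([tvec_low_int]).  Applying this to the vector
    [tv N u w], with [w] integral, shows that [c^2] is rational.

    As [W] has dimension at least [4], there is an integral [w] orthogonal to [f]
    and not proportional to it; the transvections along [u] and along its
    translates by multiples of [w] give root elements whose logarithm is a
    multiple of [w q], where [q = c p] ([root_element]).  Commutators and
    conjugation by the corner produce all the root elements [w q] for [w] in a
    lattice of [W], together with a transvection along [q] ([root_lattice]).
    Zariski density gives two independent such vectors [q] in [P], and the gap
    argument shows that their pairing is rational.  After a change of basis [C] of
    [P], the group contains the [m]-th powers of all the elementary root elements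
    between [W] and [P] with respect to the standard lattice ([integral_frame]).

    The classical stable range argument for integral symplectic matrices then
    moves every primitive vector congruent modulo [m^2] to a basis vector of [P]
    to that vector, so every element of [Sp_g(Z)] congruent to [1] modulo [m^2]
    lies in the corner [Sp_(g-1)(Z)] up to an element of the group
    ([congruence_factor]).  As the
    group contains a subgroup of finite index of the corner, its intersection with
    [Sp_g(Z)] has finite index in [Sp_g(Z)] ([finite_index_corner]).

    Conversely the group now contains [tv M v] for all integral [v].  For [A] in
    the group, the bilinear form [om (A v) w] on integral vectors has a gap at [0],
    which forces [A = c X] with [X] integral and [c >= 1 / M]
    ([scaled_integral]).  Hence [d = c^-2] is an integer at most [M^2], and the
    coset of [A] modulo integral elements depends only on [d] and on [X] modulo
    [d] ([finite_index_integral]). *)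

(** * The symplectic form and root elements *)

Section SymplecticSpace.
Variables (K : numDomainType) (g : nat).
Local Notation n := (2 * g)%N.
Local Notation J := (symp_form K g).
Implicit Types (x y u v w q : 'cV[K]_n) (A B : 'M[K]_n) (a s t : K).

Lemma ltn_partner (i : 'I_n) : ((if odd i then i.-1 else i.+1) < n)%N.
Proof. case: i => i /= hi; case: ifP => oi; lia. Qed.

Definition partner (i : 'I_n) : 'I_n := Ordinal (ltn_partner i).

Lemma partnerK : involutive partner.
Proof. by move=> i; apply: val_inj; case: i => i hi /=; case oi: (odd i); case: ifP; lia. Qed.

Lemma symp_form_partner (i j : 'I_n) :
  J i j = if j == partner i then (-1) ^+ odd i else 0.
Proof.
rewrite mxE -val_eqE /=; case: i j => i hi [j hj] /=.
have [ij|ij] := eqVneq (i %/ 2)%N (j %/ 2)%N; last first.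
  by rewrite ifF //; apply/eqP; case: ifP; lia.
have [->|hij] := eqVneq i j.
  by rewrite ltnn subrr ifF //; apply/eqP; case: ifP; lia.
case oi: (odd i); rewrite ifT; try by apply/eqP; lia.
  have -> : (i < j)%N = false by lia.
  have -> : (j < i)%N by lia.
  by rewrite sub0r expr1.
have -> : (j < i)%N = false by lia.
have -> : (i < j)%N by lia.
by rewrite subr0 expr0.
Qed.

Lemma tr_symp_form : J^T = - J.
Proof. by apply/matrixP => i j; rewrite !mxE eq_sym; case: ifP; rewrite ?opprB ?oppr0. Qed.

Lemma mulmx_symp_form : J *m J = - 1%:M.
Proof.
apply/matrixP => i k; rewrite !mxE (bigD1 (partner i)) //= big1 => [|j hj].
  rewrite !symp_form_partner eqxx addr0 partnerK eq_sym.
  case: eqP => _; last by rewrite mulr0 oppr0.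
  have -> : odd (partner i) = ~~ odd i by move=> /=; case: ifP; case: i => i /= _; lia.
  by case: (odd i); rewrite /= expr0 expr1 ?mulr1 ?mul1r.
by rewrite symp_form_partner (negbTE hj) mul0r.
Qed.

Definition om x y : K := (x^T *m J *m y) 0 0.

Lemma omDl x y w : om (x + y) w = om x w + om y w.
Proof. by rewrite /om raddfD /= !mulmxDl mxE. Qed.
Lemma omDr x y w : om w (x + y) = om w x + om w y.
Proof. by rewrite /om !mulmxDr mxE. Qed.
Lemma omZl a x y : om (a *: x) y = a * om x y.
Proof. by rewrite /om linearZ /= -!scalemxAl mxE. Qed.
Lemma omZr a x y : om x (a *: y) = a * om x y.
Proof. by rewrite /om -!scalemxAr mxE. Qed.
Lemma om0r x : om x 0 = 0.
Proof. by rewrite /om mulmx0 mxE. Qed.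
Lemma om_anti x y : om x y = - om y x.
Proof.
have -> : om y x = (y^T *m J *m x)^T 0 0 by rewrite [RHS]mxE.
by rewrite !trmx_mul trmxK tr_symp_form mulNmx mulmxN mxE opprK mulmxA.
Qed.
Lemma omxx x : om x x = 0.
Proof.
have /eqP := om_anti x x; rewrite -addr_eq0 -mulr2n -mulr_natl mulf_eq0 pnatr_eq0 /=.
by move/eqP.
Qed.
Lemma omNr x y : om x (- y) = - om x y.
Proof. by rewrite -scaleN1r omZr mulN1r. Qed.
Lemma om0l x : om 0 x = 0.
Proof. by rewrite om_anti om0r oppr0. Qed.
Lemma omNl x y : om (- x) y = - om x y.
Proof. by rewrite -scaleN1r omZl mulN1r. Qed.

Definition omE := (omDl, omDr, omNl, omNr, omZl, omZr, om0l, om0r, omxx).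

(** As the form is unimodular, each coordinate is a pairing with an integral
    vector; lower bounds on pairings become statements on coordinates. *)
Definition dual_basis (i : 'I_n) : 'cV[K]_n := - (J *m delta_mx i 0).

Lemma om_dual_basis x i : om x (dual_basis i) = x i 0.
Proof.
rewrite /om mulmxN mulmxA -(mulmxA x^T J J) mulmx_symp_form mulmxN mulmx1 !mulNmx opprK.
by rewrite -colE !mxE.
Qed.

Lemma om_delta (i j : 'I_n) : om (delta_mx i 0) (delta_mx j 0) = J i j.
Proof. by rewrite /om -colE trmx_delta -rowE !mxE. Qed.

Lemma mulmx_rank1 x y w : (x *m (y^T *m J)) *m w = om y w *: x.
Proof.
apply/colP => i.
by rewrite -mulmxA mxE big_ord1 [RHS]mxE mulrC.
Qed.

Lemma mx_act_inj (A B : 'M[K]_n) : (forall x : 'cV_n, A *m x = B *m x) -> A = B.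
Proof.
move=> h; apply/matrixP => i j; have := h (delta_mx j 0); rewrite -!colE.
by move/colP/(_ i); rewrite !mxE.
Qed.

Lemma Sp_om A : Sp K g A <-> forall x y, om (A *m x) (A *m y) = om x y.
Proof.
split=> [hA x y|hA].
  by rewrite /om trmx_mul -!mulmxA (mulmxA A^T) (mulmxA (A^T *m _)) hA.
rewrite /Sp /=; apply/matrixP => i j.
rewrite -om_delta -hA /om trmx_mul trmx_delta !mulmxA.
by rewrite -(mulmxA (delta_mx 0 i)) -(mulmxA (delta_mx 0 i)) -rowE -colE !mxE.
Qed.

Lemma Sp1 : Sp K g 1%:M.
Proof. by apply/Sp_om => x y; rewrite !mul1mx. Qed.

Lemma SpM A B : Sp K g A -> Sp K g B -> Sp K g (A *m B).
Proof. by move=> /Sp_om hA /Sp_om hB; apply/Sp_om => x y; rewrite -!mulmxA hA hB. Qed.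

Definition sp_inv A : 'M[K]_n := - (J *m A^T *m J).

Lemma sp_invK A : Sp K g A -> sp_inv A *m A = 1%:M.
Proof.
move=> hA; rewrite /sp_inv mulNmx -!mulmxA (mulmxA A^T) hA.
by rewrite mulmx_symp_form opprK.
Qed.

Lemma Sp_unit A : Sp K g A -> A \in unitmx.
Proof. by move=> /sp_invK/mulmx1_unit[]. Qed.

Lemma Sp_invmx A : Sp K g A -> invmx A = sp_inv A.
Proof.
move=> hA; rewrite -[RHS]mulmx1 -(mulmxV (Sp_unit hA)) mulmxA sp_invK //.
by rewrite mul1mx.
Qed.

Lemma SpV A : Sp K g A -> Sp K g (invmx A).
Proof.
move=> hA; apply/Sp_om => x y; have /Sp_om h := hA.
by rewrite -h !mulmxA mulmxV ?mul1mx // Sp_unit.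
Qed.

(** The symplectic transvection along [u], a long root element of [Sp]. *)
Definition tv s u : 'M[K]_n := 1%:M + s *: (u *m (u^T *m J)).

(** With the Lie algebra of [Sp] seen as the symmetric square of the space, the
    logarithm of [tv s u] is [s u^2] and, for [om u v = 0], that of [el u v] is
    [2 u v]: these are the short root elements. *)
Definition el u v : 'M[K]_n := 1%:M + u *m (v^T *m J) + v *m (u^T *m J).

Lemma tvE s u x : tv s u *m x = x + (s * om u x) *: u.
Proof. by rewrite mulmxDl mul1mx -scalemxAl mulmx_rank1 scalerA. Qed.

Lemma elE u v x : el u v *m x = x + om v x *: u + om u x *: v.
Proof. by rewrite !mulmxDl mul1mx !mulmx_rank1. Qed.

Lemma tv_Sp s u : Sp K g (tv s u).
Proof.
apply/Sp_om => x y; rewrite !tvE !omE [om x u]om_anti; ring.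
Qed.

Lemma el_Sp u v : om u v = 0 -> Sp K g (el u v).
Proof.
move=> uv; apply/Sp_om => x y; rewrite !elE !omE [om v u]om_anti uv.
rewrite [om x u]om_anti [om x v]om_anti; ring.
Qed.

Lemma tvD s t u : tv s u *m tv t u = tv (s + t) u.
Proof.
apply: mx_act_inj => x; rewrite -mulmxA !tvE !omE.
by apply/colP => i; rewrite !mxE; ring.
Qed.

Lemma tv0 u : tv 0 u = 1%:M.
Proof. by rewrite /tv scale0r addr0. Qed.

Lemma tvZ s a u : tv s (a *: u) = tv (s * a ^+ 2) u.
Proof.
apply: mx_act_inj => x; rewrite !tvE !omE.
by apply/colP => i; rewrite !mxE; ring.
Qed.

Lemma tvV s u : invmx (tv s u) = tv (- s) u.
Proof.
rewrite -[RHS]mulmx1 -(mulmxV (Sp_unit (tv_Sp s u))) mulmxA tvD addNr tv0.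
by rewrite mul1mx.
Qed.

Lemma conj_tv A s u : Sp K g A -> A *m tv s u *m invmx A = tv s (A *m u).
Proof.
move=> hA; apply: (can_inj (mulmxK (Sp_unit hA))); rewrite mulmxKV ?Sp_unit //.
apply: mx_act_inj => x; rewrite -!mulmxA !tvE mulmxDr -scalemxAr.
by have /Sp_om -> := hA.
Qed.

Lemma conj_el A u v : Sp K g A -> A *m el u v *m invmx A = el (A *m u) (A *m v).
Proof.
move=> hA; apply: (can_inj (mulmxK (Sp_unit hA))); rewrite mulmxKV ?Sp_unit //.
apply: mx_act_inj => x; rewrite -!mulmxA !elE !mulmxDr -!scalemxAr.
by have /Sp_om h := hA; rewrite !h.
Qed.

Lemma elC u v : el u v = el v u.
Proof. by rewrite /el -!addrA [X in _ + X]addrC. Qed.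

Lemma elZ a u v : el (a *: u) v = el u (a *: v).
Proof.
apply: mx_act_inj => x; rewrite !elE !omE.
by apply/colP => i; rewrite !mxE; ring.
Qed.

(** Polarization: [(u + v)^2 - u^2 - v^2 = 2 u v] for commuting logarithms. *)
Lemma tv_polar s u v : om u v = 0 ->
  tv s (u + v) *m tv (- s) u *m tv (- s) v = el (s *: u) v.
Proof.
move=> uv; apply: mx_act_inj => x; rewrite -!mulmxA !tvE !elE !omE.
rewrite [om v u]om_anti uv.
by apply/colP => i; rewrite !mxE; ring.
Qed.

(** A Heisenberg group: additivity in [u] fails by a transvection along [q]. *)
Lemma elM u v q : om u q = 0 -> om v q = 0 ->
  el u q *m el v q = tv (om u v) q *m el (u + v) q.
Proof.
move=> uq vq; apply: mx_act_inj => x; rewrite -!mulmxA !tvE !elE !omE.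
rewrite [om q u]om_anti [om q v]om_anti uq vq.
by apply/colP => i; rewrite !mxE; ring.
Qed.

Lemma el0 u : el u 0 = 1%:M.
Proof. by rewrite /el trmx0 mul0mx mulmx0 mul0mx !addr0. Qed.

Lemma elV u q : om u q = 0 -> invmx (el u q) = el (- u) q.
Proof.
move=> uq; rewrite -[RHS]mulmx1 -(mulmxV (Sp_unit (el_Sp uq))) mulmxA.
by rewrite elM ?omE ?uq ?oppr0 // tv0 mul1mx addNr (elC 0) el0 mul1mx.
Qed.

Lemma el_comm u v q : om u q = 0 -> om v q = 0 ->
  el u q *m el v q *m invmx (el u q) *m invmx (el v q) = tv (2 * om u v) q.
Proof.
move=> uq vq; rewrite !elV //.
apply: mx_act_inj => x; rewrite -!mulmxA !tvE !elE !omE.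
rewrite [om q u]om_anti [om q v]om_anti [om v u]om_anti uq vq.
by apply/colP => i; rewrite !mxE; ring.
Qed.

End SymplecticSpace.
Arguments om {K g}.
Arguments tv {K g}.
Arguments el {K g}.
Arguments dual_basis {K g}.
Arguments omE {K g}.

(** * Shimizu's inequality *)

Section Shimizu.
Variables (R : realType) (g : nat).
Local Notation n := (2 * g)%N.

Lemma expr_small (q e : R) : 0 <= q < 1 -> 0 < e -> exists k, q ^+ k < e.
Proof.
case/andP=> q0 q1 e0; have [->|q0'] := eqVneq q 0.
  by exists 1%N; rewrite expr1.
have qp : 0 < q by rewrite lt_def q0'.
pose h := q^-1 - 1.
have h0 : 0 < h by rewrite subr_gt0 invf_gt1.
have hE : q^-1 = 1 + h by rewrite /h addrC subrK.
have bernoulli k : 1 + k%:R * h <= (1 + h) ^+ k.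
  elim: k => [|k ih]; first by rewrite mul0r addr0 expr0.
  rewrite exprS; apply: (@le_trans _ _ ((1 + h) * (1 + k%:R * h))).
    rewrite -subr_ge0 -natr1.
    have -> : (1 + h) * (1 + k%:R * h) - (1 + (k%:R + 1) * h) = k%:R * h ^+ 2 by ring.
    by rewrite mulr_ge0 // exprn_ge0 // ltW.
  by rewrite ler_wpM2l // addr_ge0 // ltW.
have x0 : 0 <= e^-1 / h by rewrite mulr_ge0 ?invr_ge0 ?ltW.
have := archi_boundP x0; set k := Num.bound _ => hk.
exists k; rewrite -[q]invrK exprVn invf_plt ?posrE ?exprn_gt0 ?invr_gt0 //.
rewrite hE; apply: lt_le_trans (bernoulli k).
by rewrite ltr_pdivrMr // in hk; apply: (lt_trans hk); rewrite ltrDr.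
Qed.

Lemma discrete_gap (G : set 'M[R]_n) A : discrete_subset G -> G A ->
  exists2 e : R, 0 < e &
    forall B, G B -> (forall i j, `|A i j - B i j| < e) -> B = A.
Proof.
move=> Gd GA; have [_ [V /nbhs_ballP[e e0 AeV] VG]] := Gd A GA.
exists e => // B GB AB.
suff : (V `&` G) B by rewrite VG.
by split=> //; apply: AeV.
Qed.

Variable G : set 'M[R]_n.
Hypothesis G_subgroup : mx_subgroup G.
Hypothesis G_discrete : discrete_subset G.

Section Iteration.
Variables (s : R) (u v : 'cV[R]_n).

Fixpoint shimizu_seq k : 'cV[R]_n :=
  if k is k'.+1 then tv s (shimizu_seq k') *m u else v.

Local Notation w := shimizu_seq.
Let c k := s * om u (w k).

Lemma shimizu_seqS k : w k.+1 = u - c k *: w k.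
Proof. by rewrite /= tvE om_anti mulrN scaleNr. Qed.

Lemma shimizu_coefS k : c k.+1 = - c k ^+ 2.
Proof. by rewrite {1}/c shimizu_seqS !omE /c; ring. Qed.

Lemma shimizu_coef_neq0 k : c 0%N != 0 -> c k != 0.
Proof.
by move=> c0; elim: k => // k ih; rewrite shimizu_coefS oppr_eq0 expf_neq0.
Qed.

Lemma shimizu_coef_le k : `|c 0%N| <= 1 -> `|c k| <= `|c 0%N| ^+ k.+1.
Proof.
move=> c1; elim: k => [|k ih]; first by rewrite expr1.
rewrite shimizu_coefS normrN normrX expr2 [leRHS]exprS ler_pM //.
by apply: (le_trans ih); rewrite exprS ler_piMr // exprn_ile1.
Qed.

(** The whole sequence stays in the plane of [u] and [v], so its convergence is
    that of two scalars. *)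
Lemma shimizu_seq_span k : `|c 0%N| < 1 -> c 0%N != 0 ->
  exists2 a : R, `|a| <= (1 - `|c 0%N|)^-1 & w k = a *: u + (c k / c 0%N) *: v.
Proof.
move=> c1 c0; elim: k => [|k [a aA wk]].
  exists 0; first by rewrite normr0 invr_ge0 subr_ge0 ltW.
  by rewrite scale0r add0r divff // scale1r.
exists (1 - c k * a); last first.
  rewrite shimizu_seqS wk shimizu_coefS.
  by apply/colP => i; rewrite !mxE; ring.
have q0 : 0 < 1 - `|c 0%N| by rewrite subr_gt0.
have -> : (1 - `|c 0%N|)^-1 = 1 + `|c 0%N| * (1 - `|c 0%N|)^-1.
  by field; apply: lt0r_neq0.
rewrite (le_trans (ler_normB _ _)) // normr1 lerD2l normrM ler_pM //.
apply: (le_trans (shimizu_coef_le k (ltW c1))).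
by rewrite exprS ler_piMr // exprn_ile1 // ltW.
Qed.

Lemma shimizu_seq_mem k : G (tv s u) -> G (tv s v) -> G (tv s (w k)).
Proof.
have [_ _ GM GV] := G_subgroup.
move=> Gu Gv; elim: k => //= k ih.
rewrite -conj_tv; last exact: tv_Sp.
exact: (GM _ _ (GM _ _ ih Gu) (GV _ ih)).
Qed.

Lemma tv_spanE a b (i j : 'I_n) :
  tv s u i j - tv s (a *: u + b *: v) i j =
  (1 - a ^+ 2) * (s * (u *m (u^T *m symp_form R g)) i j)
  - a * b * (s * ((u *m (v^T *m symp_form R g)) i j + (v *m (u^T *m symp_form R g)) i j))
  - b ^+ 2 * (s * (v *m (v^T *m symp_form R g)) i j).
Proof.
rewrite /tv !mxE !big_ord1 !mxE.
have -> : \sum_k (a *: u + b *: v)^T 0 k * symp_form R g k j =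
  a * (\sum_k u^T 0 k * symp_form R g k j) + b * \sum_k v^T 0 k * symp_form R g k j.
  rewrite !mulr_sumr -big_split /=; apply: eq_bigr => k _; rewrite [in LHS]mxE [in LHS]mxE !mxE; ring.
ring.
Qed.

End Iteration.

(** Shimizu's inequality for transvections.  If [0 < s |om u v| < 1], the
    vectors [u_(k+1) = tv s u_k u] satisfy
    [s om(u, u_(k+1)) = - (s om(u, u_k))^2], so they converge to [u] without
    ever being fixed by [tv s u]: the element [tv s u] is not isolated. *)
Lemma shimizu (s : R) u v : 0 < s -> G (tv s u) -> G (tv s v) ->
  om u v = 0 \/ 1 <= s * `|om u v|.
Proof.
move=> s0 Gu Gv; have [->|uv0] := eqVneq (om u v) 0; first by left.
right; rewrite leNgt; apply/negP => q1.
pose w := shimizu_seq s u v; pose c k := s * om u (w k).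
have c00 : c 0%N != 0 by rewrite mulf_neq0 // lt0r_neq0.
have q1' : `|c 0%N| < 1 by rewrite normrM (gtr0_norm s0).
set q := `|c 0%N| in q1'.
have [e e0 isol] := discrete_gap G_discrete Gu.
pose T := \sum_i \sum_j
  (`|s * (u *m (u^T *m symp_form R g)) i j|
   + `|s * ((u *m (v^T *m symp_form R g)) i j + (v *m (u^T *m symp_form R g)) i j)|
   + `|s * (v *m (v^T *m symp_form R g)) i j|).
have T0 : 0 <= T by apply: sumr_ge0 => i _; apply: sumr_ge0 => j _; rewrite !addr_ge0.
have le_T i j : `|s * (u *m (u^T *m symp_form R g)) i j|
   + `|s * ((u *m (v^T *m symp_form R g)) i j + (v *m (u^T *m symp_form R g)) i j)|
   + `|s * (v *m (v^T *m symp_form R g)) i j| <= T.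
  rewrite /T (bigD1 i) //=; apply: ler_wpDr.
    by apply: sumr_ge0 => i' _; apply: sumr_ge0 => j' _; rewrite !addr_ge0.
  rewrite (bigD1 j) //=; apply: ler_wpDr => //.
  by apply: sumr_ge0 => j' _; rewrite !addr_ge0.
pose A := (1 - q)^-1.
have A1 : 1 <= A by rewrite invf_ge1 ?subr_gt0 // gerBl normr_ge0.
have A0 : 0 < A by apply: lt_le_trans A1.
have [k hk] : exists k, q ^+ k < e / (A * (A + 1) * (T + 1)).
  apply: expr_small; first by rewrite normr_ge0.
  by rewrite divr_gt0 // !mulr_gt0 // ltr_wpDl // ltW.
have [a aA wk] := shimizu_seq_span k.+1 q1' c00.
have [a' a'A wk'] := shimizu_seq_span k q1' c00.
rewrite -/w -/(c _) -/q -/A in aA wk a'A wk'.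
have aE : a = 1 - c k * a'.
  have := congr1 (fun x => om x v) wk; rewrite /w shimizu_seqS -/w -/(c k) wk'.
  rewrite !omE !mulr0 !addr0 => h; apply: (mulIf uv0); rewrite -h; ring.
have ck : `|c k| <= q ^+ k.+1 := shimizu_coef_le k (ltW q1').
have cSk : `|c k.+1 / c 0%N| <= q ^+ k.
  rewrite normf_div ler_pdivrMr ?normr_gt0 // -exprSr.
  apply: (le_trans (shimizu_coef_le k.+1 (ltW q1'))).
  by rewrite exprS ler_piMl // ?exprn_ge0 // ltW.
set b := c k.+1 / c 0%N in cSk wk.
have qk0 : 0 <= q ^+ k by rewrite exprn_ge0 // normr_ge0.
have qk1 : q ^+ k <= 1 by rewrite exprn_ile1 // ?normr_ge0 // ltW.
have a1 : `|1 - a| <= q ^+ k * A.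
  rewrite aE opprB addrC subrK normrM ler_pM //.
  by apply: (le_trans ck); rewrite exprS ler_piMl // ltW.
pose eta := q ^+ k * (A * (A + 1)).
have h1 : `|1 - a ^+ 2| <= eta.
  have -> : 1 - a ^+ 2 = (1 - a) * (1 + a) by ring.
  rewrite normrM /eta mulrA ler_pM //.
  by rewrite (le_trans (ler_normD _ _)) // normr1 addrC lerD2r.
have h2 : `|a * b| <= eta.
  rewrite normrM /eta mulrC ler_pM // (le_trans aA) // ler_peMr ?ltW //.
  by rewrite ltrDr.
have h3 : `|b ^+ 2| <= eta.
  rewrite normrX expr2 /eta ler_pM // (le_trans cSk) // (le_trans qk1) //.
  by rewrite (le_trans A1) // ler_peMr ?(ltW A0) // lerDr ltW.
have Gw := shimizu_seq_mem k.+1 Gu Gv; rewrite -/w in Gw.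
have tvw : tv s (w k.+1) = tv s u.
  apply: isol => // i j; rewrite wk tv_spanE.
  set x1 := (X in (1 - _) * X); set x2 := (X in a * b * X); set x3 := (X in b ^+ 2 * X).
  have := le_T i j; rewrite -/x1 -/x2 -/x3 => xT.
  have : `|(1 - a ^+ 2) * x1 - a * b * x2 - b ^+ 2 * x3| <= eta * T.
    rewrite (le_trans (ler_normB _ _)) //.
    rewrite (le_trans (lerD (ler_normB _ _) (lexx _))) // !(normrM _ x1, normrM _ x2, normrM _ x3).
    apply: (@le_trans _ _ (eta * (`|x1| + `|x2| + `|x3|))).
      by rewrite !mulrDr !lerD // ler_wpM2r.
    by rewrite ler_wpM2l // (le_trans _ h1).
  move/le_lt_trans; apply.
  apply: (@le_lt_trans _ _ (eta * (T + 1))).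
    by rewrite ler_wpM2l ?lerDl ?(le_trans _ h1).
  by rewrite /eta -mulrA -ltr_pdivlMr // !mulr_gt0 // ltr_wpDl // ltW.
have := congr1 (fun M => M *m u) tvw.
rewrite !tvE omxx mulr0 scale0r addr0 => /eqP.
rewrite -subr_eq0 addrAC subrr add0r => /eqP /(congr1 (om u)).
rewrite !omE om_anti mulrN => /eqP.
have := shimizu_coef_neq0 k.+1 c00; rewrite -/w -/(c _) /c.
rewrite mulf_eq0 negb_or => /andP[_ hw].
by rewrite mulNr oppr_eq0 !mulf_eq0 (negbTE hw) gt_eqF.
Qed.

End Shimizu.

(** * Gaps, rationality and integral vectors *)

Section Gaps.
Variable R : realType.

Definition is_rat (x : R) := exists r : rat, x = ratr r.

Lemma is_ratM x y : is_rat x -> is_rat y -> is_rat (x * y).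
Proof. by move=> [r ->] [t ->]; exists (r * t); rewrite rmorphM. Qed.
Lemma is_ratB x y : is_rat x -> is_rat y -> is_rat (x - y).
Proof. by move=> [r ->] [t ->]; exists (r - t); rewrite rmorphB. Qed.
Lemma is_ratV x : is_rat x -> is_rat x^-1.
Proof. by move=> [r ->]; exists r^-1; rewrite fmorphV. Qed.
Lemma is_rat_int (k : int) : is_rat k%:~R.
Proof. by exists k%:~R; rewrite ratr_int. Qed.
Lemma is_rat_nat (k : nat) : is_rat k%:R.
Proof. by exists k%:R; rewrite ratr_nat. Qed.

Lemma is_rat_denom x : is_rat x ->
  exists2 k : int, 0 < k & exists l : int, k%:~R * x = l%:~R.
Proof.
move=> [r ->]; exists (denq r); first exact: denq_gt0.
exists (numq r).
have : (denq r)%:~R * r = (numq r)%:~R :> rat.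
  by rewrite mulrC -[X in X * _]divq_num_den mulfVK // intq_eq0 denq_neq0.
by move/(congr1 (fun z => ratr z : R)); rewrite rmorphM /= !ratr_int.
Qed.

(** The values of [phi] other than [0] stay away from [0], so they form a
    cyclic group; any positive value below twice the gap generates it. *)
Lemma gap_cyclic (V : lmodType int) (phi : V -> R) (c : R) v0 :
  (forall (k : int) x y, phi (k *: x + y) = k%:~R * phi x + phi y) ->
  (forall v, phi v = 0 \/ c <= `|phi v|) ->
  0 < phi v0 -> phi v0 < 2 * c ->
  forall v, exists k : int, phi v = k%:~R * phi v0.
Proof.
move=> phiL gap v0p v0c v.
pose x := phi v / phi v0 + 2^-1; pose k := Num.floor x.
exists k; apply/eqP; rewrite -subr_eq0; apply/eqP.
have -> : phi v - k%:~R * phi v0 = phi ((- k) *: v0 + v).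
  by rewrite phiL rmorphN mulNr addrC.
case: (gap ((- k) *: v0 + v)) => // ge_c; exfalso.
have : `|phi (- k *: v0 + v)| <= phi v0 / 2.
  rewrite phiL rmorphN /=.
  have -> : - k%:~R * phi v0 + phi v = (x - k%:~R - 2^-1) * phi v0.
    by rewrite /x; field; apply: lt0r_neq0.
  rewrite normrM (gtr0_norm v0p) mulrC ler_pM2l // ler_norml.
  have /andP[h1 h2] := floor_itv x; rewrite -/k in h1 h2.
  rewrite rmorphD /= in h2; lra.
by move: ge_c v0c; lra.
Qed.

(** The infimum [c'] of the positive values need not be known to be attained: a
    value below [2 c'] is enough for [gap_cyclic]. *)
Lemma gap_min (E : set R) (c : R) :
  (forall x, E x -> x = 0 \/ c <= `|x|) -> 0 < c -> (exists2 x, E x & 0 < x) ->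
  exists x0, [/\ E x0, 0 < x0 & exists2 c', c <= c' &
    x0 < 2 * c' /\ forall x, E x -> 0 < x -> c' <= x].
Proof.
move=> gap c0 [x1 Ex1 x10].
pose F := [set x | E x /\ 0 < x].
have lbF : lbound F c.
  by move=> x [Ex x0]; case: (gap x Ex) => [xz|]; [rewrite xz ltxx in x0|rewrite gtr0_norm].
have infF : has_inf F by split; [exists x1|exists c].
have ge_c : c <= inf F by apply: lb_le_inf => //; exists x1.
have c'0 : 0 < inf F by apply: lt_le_trans ge_c.
have [x0 [Ex0 x00] hx0] := inf_adherent c'0 infF.
exists x0; split=> //; exists (inf F) => //.
split; first by rewrite mulr_natl.
by move=> x Ex x0'; apply: (ge_inf (proj2 infF)).
Qed.

End Gaps.

Notation zv := (map_mx (intr : int -> _)).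

Section Lattice.
Variables (R : realType) (g : nat).
Local Notation n := (2 * g)%N.

Lemma symp_form_int : zv (symp_form int g) = symp_form R g.
Proof.
apply/matrixP => i j; rewrite !mxE; case: ifP => _; last by rewrite rmorph0.
by rewrite rmorphB /=; case: (i < j)%N; case: (j < i)%N.
Qed.

Lemma om_zv (x y : 'cV[int]_n) : om (zv x : 'cV[R]_n) (zv y) = (om x y)%:~R.
Proof. by rewrite /om -symp_form_int map_trmx -!map_mxM mxE. Qed.

Lemma zvZ m p (a : int) (x : 'M[int]_(m, p)) : zv (a *: x) = a%:~R *: (zv x : 'M[R]_(m, p)).
Proof. by rewrite map_mxZ. Qed.

Lemma zv_tv (a : int) (x : 'cV[int]_n) : zv (tv a x) = tv a%:~R (zv x) :> 'M[R]_n.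
Proof. by rewrite /tv map_mxD map_mx1 map_mxZ !map_mxM -map_trmx symp_form_int. Qed.

Lemma zv_el (x y : 'cV[int]_n) : zv (el x y) = el (zv x) (zv y) :> 'M[R]_n.
Proof. by rewrite /el !map_mxD map_mx1 !map_mxM -!map_trmx symp_form_int. Qed.

Lemma zv_dual_basis (i : 'I_n) : zv (dual_basis i : 'cV[int]_n) = dual_basis i :> 'cV[R]_n.
Proof. by rewrite /dual_basis map_mxN map_mxM map_delta_mx symp_form_int. Qed.

Lemma zv_inj m p : injective (zv : 'M[int]_(m, p) -> 'M[R]_(m, p)).
Proof. by move=> A B /matrixP h; apply/matrixP => i j; have := h i j; rewrite !mxE => /intr_inj. Qed.

Lemma Sp_zv (A : 'M[int]_n) : Sp R g (zv A) <-> Sp int g A.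
Proof.
rewrite /Sp /= -!symp_form_int map_trmx -!map_mxM.
by split=> [/zv_inj|->].
Qed.

Lemma invmx_zv (A : 'M[int]_n) : Sp int g A -> zv (invmx A) = invmx (zv A) :> 'M[R]_n.
Proof.
move=> hA; rewrite !Sp_invmx //; last by apply/Sp_zv.
by rewrite /sp_inv map_mxN !map_mxM -map_trmx symp_form_int.
Qed.

End Lattice.

Section Corner.
Variables (K : numDomainType) (g : nat).
Local Notation n := (2 * g)%N.
Local Notation k := (2 * (g - 1))%N.

(** The symplectic space of the top left corner, and its orthogonal plane. *)
Definition low (x : 'cV[K]_n) := forall i : 'I_n, (k <= i)%N -> x i 0 = 0.
Definition high (x : 'cV[K]_n) := forall i : 'I_n, (i < k)%N -> x i 0 = 0.

Lemma om_sum (x y : 'cV[K]_n) :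
  om x y = \sum_j (\sum_i x i 0 * symp_form K g i j) * y j 0.
Proof.
by rewrite /om mxE; apply: eq_bigr => j _; rewrite mxE; congr (_ * _);
   apply: eq_bigr => i _; rewrite mxE.
Qed.

Lemma symp_form_corner (i j : 'I_n) : (i < k)%N -> (k <= j)%N -> symp_form K g i j = 0.
Proof. by move=> ik kj; rewrite mxE ifF //; apply/eqP; lia. Qed.

Lemma om_low_high x y : low x -> high y -> om x y = 0.
Proof.
move=> lx hy; rewrite om_sum big1 // => j _.
have [jk|kj] := ltnP j k; first by rewrite hy // mulr0.
rewrite big1 ?mul0r // => i _; have [ik|ki] := ltnP i k.
  by rewrite symp_form_corner // mulr0.
by rewrite lx // mul0r.
Qed.

Lemma low_dual_basis (i : 'I_n) : (i < k)%N -> low (dual_basis i).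
Proof.
move=> ik j kj; rewrite /dual_basis mxE -colE !mxE ifF ?oppr0 //.
by apply/eqP; lia.
Qed.

Lemma low_delta (i : 'I_n) : (i < k)%N -> low (delta_mx i 0).
Proof. by move=> ik j kj; rewrite mxE andbT; case: eqP => // ji; move: ik; rewrite -ji; lia. Qed.

Lemma low_comb a x y : low x -> low y -> low (a *: x + y).
Proof. by move=> lx ly i ki; rewrite !mxE lx // ly // mulr0 addr0. Qed.
Lemma lowZ a x : low x -> low (a *: x).
Proof. by move=> lx i ki; rewrite !mxE lx // mulr0. Qed.
Lemma lowD x y : low x -> low y -> low (x + y).
Proof. by move=> lx ly i ki; rewrite !mxE lx // ly // addr0. Qed.
Lemma highD x y : high x -> high y -> high (x + y).
Proof. by move=> lx ly i ki; rewrite !mxE lx // ly // addr0. Qed.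
Lemma highZ a x : high x -> high (a *: x).
Proof. by move=> lx i ki; rewrite !mxE lx // mulr0. Qed.

Definition low_part (x : 'cV[K]_n) : 'cV[K]_n := \col_i (if (i < k)%N then x i 0 else 0).
Lemma low_low_part x : low (low_part x).
Proof. by move=> i ki; rewrite mxE ltnNge ki. Qed.
Lemma low_part_id x : low x -> low_part x = x.
Proof. by move=> lx; apply/colP => i; rewrite mxE; case: ltnP => // /lx ->. Qed.
Lemma low_part_comb a x y : low_part (a *: x + y) = a *: low_part x + low_part y.
Proof. by apply/colP => i; rewrite !mxE; case: ltnP => _; rewrite ?mulr0 ?addr0. Qed.

End Corner.

Lemma low_zv (R : realType) g (x : 'cV[int]_(2 * g)) : low x -> low (zv x : 'cV[R]_(2 * g)).
Proof. by move=> lx i ki; rewrite mxE lx // rmorph0. Qed.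

(** * Root elements from a group containing the corner transvections *)

Section CornerVectors.
Variables (R : realType) (g : nat).
Local Notation n := (2 * g)%N.
Local Notation k := (2 * (g - 1))%N.
Variable G : set 'M[R]_n.
Hypothesis G_subgroup : mx_subgroup G.
Hypothesis G_Sp : G `<=` Sp R g.
Hypothesis G_gap : forall s u v, 0 < s -> G (tv s u) -> G (tv s v) ->
  om u v = 0 \/ 1 <= s * `|om u v|.
Variable N : nat.
Hypothesis N_gt0 : (0 < N)%N.
Hypothesis G_corner : forall v : 'cV[int]_n, low v -> G (tv N%:R (zv v)).

Let NR0 : 0 < N%:R :> R. Proof. by rewrite ltr0n. Qed.

(** The set of directions of the transvections with coefficient [N] in [G]: it
    contains the integral vectors of the corner and is stable under [G]. *)
Definition tvec u := G (tv N%:R u).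

Lemma tvec_act A u : G A -> tvec u -> tvec (A *m u).
Proof.
have [_ _ GM GV] := G_subgroup.
move=> GA Gu; rewrite /tvec -conj_tv; last exact: G_Sp.
exact: (GM _ _ (GM _ _ GA Gu) (GV _ GA)).
Qed.

Lemma tvec_low (v : 'cV[int]_n) : low v -> tvec (zv v).
Proof. exact: G_corner. Qed.

(** [v |-> om u v] is bounded away from [0] outside its kernel on the integral
    vectors of the corner, hence takes values in a cyclic group. *)
Lemma tvec_low_int u : tvec u -> (exists2 i : 'I_n, (i < k)%N & u i 0 != 0) ->
  exists c : R, exists f : 'cV[int]_n, exists p : 'cV[R]_n,
    [/\ 0 < c, low f, high p & u = c *: zv f + p].
Proof.
move=> Xu [i0 i0k ui0].
pose phi (v : 'cV[int]_n) := om u (zv (low_part v)).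
have phiL (a : int) x y : phi (a *: x + y) = a%:~R * phi x + phi y.
  by rewrite /phi low_part_comb map_mxD zvZ !omE.
have phi0 : phi 0 = 0.
  by have /eqP := phiL 1 0 0; rewrite scaler0 addr0 mul1r addrC -subr_eq subrr => /eqP.
have phiN v : phi (- v) = - phi v.
  by rewrite -scaleN1r -[_ *: v]addr0 phiL phi0 addr0 rmorphN mulN1r.
have gap v : phi v = 0 \/ N%:R^-1 <= `|phi v|.
  have Xv := tvec_low (low_low_part v).
  case: (G_gap NR0 Xu Xv) => [h|h]; first by left.
  by right; rewrite -[_^-1]mul1r ler_pdivrMr // mulrC.
have phi_dual (i : 'I_n) : (i < k)%N -> phi (dual_basis i) = u i 0.
  move=> ik; rewrite /phi low_part_id; last exact: low_dual_basis.
  by rewrite zv_dual_basis om_dual_basis.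
have [x0 [[v0 _ v0x] x00 [c' cc' [x0c' minE]]]] : exists x0, [/\ range phi x0, 0 < x0 &
  exists2 c', N%:R^-1 <= c' & x0 < 2 * c' /\ forall x, range phi x -> 0 < x -> c' <= x].
  apply: gap_min => [x [v _ <-]|| ]; [exact: gap|by rewrite invr_gt0|].
  have [u0|u0] := ltP 0 (u i0 0).
    by exists (u i0 0) => //; exists (dual_basis i0); rewrite ?phi_dual.
  exists (- u i0 0); last by rewrite oppr_gt0 lt_def eq_sym ui0.
  by exists (- dual_basis i0) => //; rewrite phiN phi_dual.
have gap' v : phi v = 0 \/ c' <= `|phi v|.
  have [pv|pv|->] := ltgtP 0 (phi v); last by left.
    by right; rewrite gtr0_norm // minE.
  right; rewrite ltr0_norm // minE ?oppr_gt0 //.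
  by exists (- v).
rewrite -v0x in x00 x0c'.
have [kf kfE] := choice (gap_cyclic phiL gap' x00 x0c').
pose f : 'cV[int]_n := \col_i (if (i < k)%N then kf (dual_basis i) else 0).
exists (phi v0), f, (u - phi v0 *: zv f); split=> //.
- by move=> i ki; rewrite mxE ltnNge ki.
- by move=> i ik; rewrite !mxE ik mulrC -kfE phi_dual // subrr.
- by rewrite addrC subrK.
Qed.

Lemma tvec_ratio u (i j : 'I_n) : tvec u -> (i < k)%N -> (j < k)%N -> u i 0 != 0 ->
  is_rat (u j 0 / u i 0).
Proof.
move=> Xu ik jk ui.
have [|c [f [p [c0 _ hp uE]]]] := tvec_low_int Xu; first by exists i.
have -> : u j 0 / u i 0 = (f j 0)%:~R / (f i 0)%:~R.
  rewrite uE !mxE !hp // !addr0 in ui *.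
  by rewrite mulf_eq0 negb_or in ui; case/andP: ui => cn fn; field; apply/andP; split.
by apply: is_ratM; [|apply: is_ratV]; apply: is_rat_int.
Qed.

(** Applying the transvection along [u] to an integral vector yields another
    vector with rational direction; this involves [c] only through [c^2]. *)
Lemma tvec_low_rat u : tvec u -> (exists2 i : 'I_n, (i < k)%N & u i 0 != 0) ->
  exists c : R, exists f : 'cV[int]_n, exists p : 'cV[R]_n,
    [/\ 0 < c, low f, high p, u = c *: zv f + p & is_rat (c ^+ 2)].
Proof.
move=> Xu hi; have [c [f [p [c0 lf hp uE]]]] := tvec_low_int Xu hi.
exists c, f, p; split=> //; case: hi => i ik ui.
have fi : (f i 0)%:~R != 0 :> R.
  by apply: contra ui => /eqP fi0; rewrite uE !mxE hp // fi0 mulr0 addr0.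
pose j := partner i; have jk : (j < k)%N.
  by rewrite /j /=; case: ifP; case: i ik {ui fi j} => i /= _; lia.
pose w : 'cV[int]_n := dual_basis i.
have lw : low w by apply: low_dual_basis.
have wE (l : 'I_n) : w l 0 = - symp_form int g l i.
  by rewrite /w /dual_basis mxE -colE mxE.
have wi : w i 0 = 0 by rewrite wE mxE eqxx ltnn subrr oppr0.
have wj : (w j 0)%:~R != 0 :> R.
  rewrite wE symp_form_partner /j partnerK eqxx intr_eq0 oppr_eq0.
  by rewrite expf_neq0.
pose x := tv N%:R u *m zv w.
have Xx : tvec x by apply: tvec_act => //; apply: tvec_low.
have uw : om u (zv w) = c * (f i 0)%:~R.
  rewrite uE !omE om_zv om_dual_basis [om p _]om_anti om_low_high ?oppr0 ?addr0 //.
  exact: low_zv.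
have xE (l : 'I_n) : (l < k)%N ->
    x l 0 = (w l 0)%:~R + N%:R * (c ^+ 2 * (f i 0)%:~R * (f l 0)%:~R).
  move=> lk; rewrite /x tvE uw uE !mxE hp //; ring.
have cn : c != 0 by apply: lt0r_neq0.
have Nn : N%:R != 0 :> R by apply: lt0r_neq0.
have xi : x i 0 != 0.
  by rewrite xE // wi rmorph0 add0r !mulf_neq0 // expf_neq0.
have := tvec_ratio Xx ik jk xi; rewrite !xE // wi => h.
have -> : c ^+ 2 = ((((w j 0)%:~R + N%:R * (c ^+ 2 * (f i 0)%:~R * (f j 0)%:~R)) /
    (0%:~R + N%:R * (c ^+ 2 * (f i 0)%:~R * (f i 0)%:~R)) - (f j 0)%:~R / (f i 0)%:~R)
    * (N%:R * (f i 0)%:~R * (f i 0)%:~R / (w j 0)%:~R))^-1.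
  by rewrite rmorph0 add0r; field; rewrite cn Nn fi wj.
apply/is_ratV/is_ratM.
  by apply: is_ratB => //; apply: is_ratM; [|apply: is_ratV]; apply: is_rat_int.
apply: is_ratM; last by apply/is_ratV/is_rat_int.
by do 2?apply: is_ratM; try exact: is_rat_int; exact: is_rat_nat.
Qed.

Let N_neq0 : N%:Z != 0. Proof. by rewrite eqz_nat -lt0n. Qed.

Lemma int_multiples (P : R -> Prop) : P 0 -> (forall x y, P x -> P y -> P (x - y)) ->
  forall (a : int) x, P x -> P (a%:~R * x).
Proof.
move=> P0 PB a x Px.
have PN y : P y -> P (- y) by move=> Py; rewrite -sub0r; apply: PB.
have Pn (b : nat) : P (b%:R * x).
  elim: b => [|b ih]; first by rewrite mul0r.
  by rewrite -natr1 mulrDl mul1r -[x in _ + x]opprK; apply: PB => //; apply: PN.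
case: a => b; first exact: Pn.
by rewrite NegzE rmorphN mulNr; apply: PN; apply: Pn.
Qed.

Lemma tv_multiple (a : int) s u : G (tv s u) -> G (tv (a%:~R * s) u).
Proof.
have [_ G1 GM GV] := G_subgroup.
apply: (int_multiples (P := fun s => G (tv s u))); first by rewrite tv0.
by move=> x y Gx Gy; rewrite -tvD; apply: GM => //; rewrite -tvV; apply: GV.
Qed.

Lemma el_multiple (a : int) u v : om u v = 0 -> G (el u v) -> G (el (a%:~R *: u) v).
Proof.
move=> uv; have [_ G1 GM GV] := G_subgroup.
rewrite -[u in el u v]scale1r -[a%:~R]mulr1.
apply: (int_multiples (P := fun s => G (el (s *: u) v))); first by rewrite scale0r elC el0.
move=> x y Gx Gy; have -> : el ((x - y) *: u) v = el (x *: u) v *m invmx (el (y *: u) v).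
  rewrite elV ?omE ?uv ?mulr0 // elM ?omE ?uv ?mulr0 ?oppr0 // tv0 mul1mx.
  by rewrite scalerBl.
by apply: GM => //; apply: GV.
Qed.

Lemma el_corner (w y : 'cV[int]_n) : low w -> low y -> om w y = 0 ->
  G (el (N%:R *: zv w) (zv y)).
Proof.
move=> lw ly wy; have [_ G1 GM GV] := G_subgroup.
have wyR : om (zv w : 'cV[R]_n) (zv y) = 0 by rewrite om_zv wy.
rewrite -(tv_polar N%:R wyR) -!tvV -map_mxD.
apply: (GM _ _ (GM _ _ _ (GV _ _)) (GV _ _)); apply: tvec_low => //.
exact: lowD.
Qed.

Hypothesis g_ge3 : (3 <= g)%N.

(** The only place where the corner must have dimension at least [4]: in a plane
    the orthogonal of [f] is spanned by [f]. *)
Lemma orthogonal_pair (f : 'cV[int]_n) (i : 'I_n) : (i < k)%N -> f i 0 != 0 ->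
  exists w y : 'cV[int]_n,
    [/\ low w, low y, w != 0, om f w = 0 & om w y = 0 /\ om f y != 0].
Proof.
move=> ik fi.
have [j [l [jk lk ji [li jl]]]] : exists j l : 'I_n,
    [/\ (j < k)%N, (l < k)%N, j != i & l != i /\ j != l].
  have h0 : (0 < n)%N by lia.
  have h1 : (1 < n)%N by lia.
  have h2 : (2 < n)%N by lia.
  have [i0|i0] := eqVneq (i : nat) 0%N.
    exists (Ordinal h1), (Ordinal h2); rewrite -!val_eqE /= i0; split=> //; lia.
  have [i1|i1] := eqVneq (i : nat) 1%N.
    exists (Ordinal h0), (Ordinal h2); rewrite -!val_eqE /= i1; split=> //; lia.
  exists (Ordinal h0), (Ordinal h1); rewrite -!val_eqE /=; split; lia.
pose ej : 'cV[int]_n := delta_mx j 0; pose el' : 'cV[int]_n := delta_mx l 0.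
have lej : low ej by apply: low_delta.
have lel : low el' by apply: low_delta.
have ejE m : ej m 0 = (m == j)%:R by rewrite mxE andbT.
have elE' m : el' m 0 = (m == l)%:R by rewrite mxE andbT.
have ly : low (dual_basis i : 'cV[int]_n) by apply: low_dual_basis.
have [fej|fej] := eqVneq (om f ej) 0.
  exists ej, (dual_basis i); split=> //; rewrite ?om_dual_basis //.
    by apply/eqP => /matrixP/(_ j 0); rewrite ejE eqxx mxE => /eqP; rewrite oner_eq0.
  by rewrite ejE eq_sym (negbTE ji).
exists (om f el' *: ej - om f ej *: el'), (dual_basis i); split=> //.
- by rewrite -scaleNr addrC; apply: low_comb => //; apply: lowZ.
- apply/eqP => /matrixP/(_ l 0).
  rewrite !mxE !andbT eqxx eq_sym (negbTE jl) mulr0 mulr1 add0r => /eqP.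
  by rewrite oppr_eq0 (negbTE fej).
- rewrite !omE; ring.
- rewrite !om_dual_basis !mxE !andbT (eq_sym i j) (eq_sym i l) (negbTE ji) (negbTE li).
  by rewrite !mulr0 subr0.
Qed.

(** With [u = c f + p], polarizing the transvections along [u] and along its
    translate [u - N c om(f, y) w] gives the root elements [w u], hence [w q] for
    [q = c p]: all the scalars that occur are integers times [c^2]. *)
Lemma root_element u : tvec u -> (exists2 i : 'I_n, (i < k)%N & u i 0 != 0) ->
  exists c : R, exists f : 'cV[int]_n, exists p : 'cV[R]_n,
    [/\ 0 < c, low f, high p, u = c *: zv f + p & is_rat (c ^+ 2) /\
     exists w : 'cV[int]_n, exists a : int,
       [/\ low w, w != 0, a != 0 & G (el (zv w) (a%:~R *: (c *: p)))]].
Proof.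
move=> Xu hi; have [_ G1 GM GV] := G_subgroup.
have [c [f [p [c0 lf hp uE c2]]]] := tvec_low_rat Xu hi.
exists c, f, p; split=> //; split=> //.
case: hi => i ik ui.
have fi : f i 0 != 0.
  by apply: contra ui => /eqP fi0; rewrite uE !mxE hp // fi0 mulr0 addr0.
have [w [y [lw ly w0 fw [wy fy]]]] := orthogonal_pair ik fi.
have [r r0 [l rl]] := is_rat_denom c2.
set t := om f y in fy.
exists w, (- (N%:Z ^+ 2 * r ^+ 2 * t)); split=> //.
  by rewrite oppr_eq0 !mulf_neq0 ?expf_neq0 ?(gt_eqF r0) // N_neq0.
have omp (v : 'cV[int]_n) : low v -> om (zv v : 'cV[R]_n) p = 0.
  by move=> lv; apply: om_low_high => //; apply: low_zv.
have ompr (v : 'cV[int]_n) : low v -> om p (zv v : 'cV[R]_n) = 0.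
  by move=> lv; rewrite om_anti omp ?oppr0.
have uw : om u (zv w) = 0 by rewrite uE !omE om_zv fw ompr // mulr0 add0r.
(* [el (N w) y] moves [u] along [w]. *)
pose b : R := - (N%:R * c * t%:~R).
have Xu1 : tvec (u + b *: zv w).
  have -> : u + b *: zv w = el (N%:R *: zv w) (zv y) *m u.
    rewrite elE omZl [om (zv w) u]om_anti uw oppr0 mulr0 scale0r addr0.
    rewrite uE !omE omp // addr0 om_zv [om y f]om_anti -/t rmorphN /b.
    by apply/colP => z; rewrite !mxE; ring.
  by apply: tvec_act => //; apply: el_corner.
have ubw : om u (b *: zv w) = 0 by rewrite omZr uw mulr0.
have Gel : G (el ((r%:~R * N%:R) *: u) (b *: zv w)).
  rewrite -(tv_polar _ ubw) -!tvV.
  apply: (GM _ _ (GM _ _ _ (GV _ _)) (GV _ _)); try exact: tv_multiple.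
  rewrite tvZ.
  have -> : r%:~R * N%:R * b ^+ 2 = (N%:Z ^+ 2 * l * t ^+ 2)%:~R * N%:R :> R.
    by rewrite /b !rmorphM /= -rl ?rmorphXn /= -?pmulrn; ring.
  by apply: tv_multiple; apply: tvec_low.
have {Gel} Gel : G (el ((- (N%:Z ^+ 2 * r * t) * l)%:~R *: zv f
     + (- (N%:Z ^+ 2 * r ^+ 2 * t))%:~R *: (c *: p)) (zv w)).
  rewrite elC elZ elC in Gel; have := el_multiple r _ Gel.
  rewrite scalerA omZl uw mulr0 => /(_ erefl); congr (G (el _ _)).
  rewrite !(rmorphN, rmorphM) /= -rl ?rmorphXn /= -?pmulrn uE /b.
  by apply/colP => z; rewrite !mxE; ring.
have Gf : G (el ((- (N%:Z ^+ 2 * r * t) * l)%:~R *: zv f) (zv w)).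
  have -> : (- (N%:Z ^+ 2 * r * t) * l)%:~R *: zv f =
     (- (N%:Z * r * t) * l)%:~R *: (N%:R *: zv f : 'cV[R]_n).
    rewrite scalerA; congr (_ *: _); rewrite !(rmorphN, rmorphM) ?rmorphXn /= -?pmulrn.
    ring.
  by apply: el_multiple; [rewrite omZl om_zv fw mulr0|apply: el_corner].
have fwR : om (zv f : 'cV[R]_n) (zv w) = 0 by rewrite om_zv fw.
have := GM _ _ Gel (GV _ Gf).
rewrite elV ?omE ?fwR ?mulr0 // elM ?omE ?fwR ?ompr ?mulr0 ?addr0 ?oppr0 //.
by rewrite tv0 mul1mx addrAC subrr add0r elC.
Qed.

(** The root elements [w q], [w] integral in the corner: conjugation by the
    transvections of the corner spreads one of them to all directions, and
    commutators produce the transvection along [q], which absorbs the defect of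
    additivity in [elM]. *)
Lemma root_lattice (q : 'cV[R]_n) (w0 : 'cV[int]_n) (a : int) :
  high q -> low w0 -> w0 != 0 -> a != 0 -> G (el (zv w0) (a%:~R *: q)) ->
  exists2 m : int, 0 < m & G (tv m%:~R q) /\
    forall v : 'cV[int]_n, low v -> G (el (zv v) (m%:~R *: q)).
Proof.
move=> hq lw0 w00 a0 Gw0; have [_ G1 GM GV] := G_subgroup.
pose L (m : int) (v : 'cV[int]_n) := G (el (zv v) (m%:~R *: q)).
have omq (v : 'cV[int]_n) : low v -> om (zv v : 'cV[R]_n) q = 0.
  by move=> lv; apply: om_low_high => //; apply: low_zv.
have Lmul m b v : low v -> L m v -> L (b * m) v.
  move=> lv Lv; rewrite /L rmorphM /= -scalerA -elZ; apply: el_multiple => //.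
  by rewrite omZr omq ?mulr0.
have LZ m b v : low v -> L m v -> L m (b *: v).
  move=> lv Lv; rewrite /L zvZ; apply: el_multiple => //.
  by rewrite omZr omq ?mulr0.
have Lconj m v w : low v -> low w -> L m w -> L m (w + (N%:Z * om v w) *: v).
  move=> lv lw Lw; have Gv : G (tv N%:R (zv v)) by apply: tvec_low.
  have := GM _ _ (GM _ _ Gv Lw) (GV _ Gv); rewrite conj_el; last exact: tv_Sp.
  rewrite !tvE !omE omq // !mulr0 scale0r addr0 om_zv /L.
  by rewrite map_mxD zvZ rmorphM /= -pmulrn.
have [i wi] : exists i, w0 i 0 != 0.
  apply/existsP; apply: contraNT w00 => /existsPn h.
  by apply/eqP/colP => i; rewrite mxE; apply/eqP; move: (h i); rewrite negbK.
have ik : (i < k)%N by rewrite ltnNge; apply: contra wi => /lw0 ->.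
pose v1 : 'cV[int]_n := dual_basis i.
have lv1 : low v1 by apply: low_dual_basis.
have v1w0 : om v1 w0 != 0 by rewrite om_anti om_dual_basis oppr_eq0.
(* [v1] fixes [q], so it conjugates the given root element to one along [w1],
   and [w0], [w1] are not orthogonal. *)
pose w1 := w0 + (N%:Z * om v1 w0) *: v1.
have lw1 : low w1 by rewrite /w1 addrC; apply: low_comb.
have Lw1 : L a w1 by apply: Lconj.
pose j : int := 2 * om w0 w1 * a ^+ 2.
have j0 : j != 0.
  have w01 : om w0 w1 != 0.
    by rewrite /w1 omDr omxx add0r omZr [om w0 v1]om_anti !mulf_neq0 // oppr_eq0.
  by rewrite /j mulf_neq0 ?expf_neq0 // mulf_neq0.
have Gj : G (tv j%:~R q).
  have ow v : low v -> om (zv v : 'cV[R]_n) (a%:~R *: q) = 0 by move=> lv; rewrite omZr omq ?mulr0.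
  have := el_comm (ow _ lw0) (ow _ lw1); rewrite om_zv tvZ.
  have -> : 2 * (om w0 w1)%:~R * a%:~R ^+ 2 = j%:~R :> R by rewrite /j !rmorphM ?rmorphXn.
  by move<-; apply: (GM _ _ (GM _ _ (GM _ _ _ _) (GV _ _)) (GV _ _)).
(* [L m] is a group as soon as [j] divides [m]. *)
have LD b v w : low v -> low w -> L (b * j) v -> L (b * j) w -> L (b * j) (v + w).
  move=> lv lw Lv Lw; have := GM _ _ Lv Lw; rewrite elM ?omZr ?omq ?mulr0 //.
  rewrite om_zv tvZ -map_mxD => h.
  have Gt : G (tv ((om v w)%:~R * (b * j)%:~R ^+ 2) q).
    have -> : (om v w)%:~R * (b * j)%:~R ^+ 2 = (om v w * b ^+ 2 * j)%:~R * j%:~R :> R.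
      by rewrite !rmorphM /= ?rmorphXn /=; ring.
    exact: tv_multiple.
  have := GM _ _ (GV _ Gt) h; rewrite mulKmx //.
  by apply/Sp_unit/G_Sp.
have Lspread v : low v -> om v w0 != 0 -> exists2 b, b != 0 & L (b * j) v.
  move=> lv vw0; exists (a * (N%:Z * om v w0)); first by rewrite !mulf_neq0.
  have h1 : L (a * j) (w0 + (N%:Z * om v w0) *: v).
    by rewrite mulrC; apply: Lmul; [rewrite addrC; apply: low_comb|apply: Lconj].
  have h2 : L (a * j) (-1 *: w0).
    by apply: LZ => //; rewrite mulrC; apply: Lmul.
  have lS : low (w0 + (N%:Z * om v w0) *: v) by rewrite addrC; apply: low_comb.
  have := LD a _ _ lS (lowZ (-1) lw0) h1 h2.
  rewrite scaleN1r addrAC subrr add0r /L zvZ elZ scalerA => h.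
  have -> : (a * (N%:Z * om v w0) * j)%:~R = (N%:Z * om v w0)%:~R * (a * j)%:~R :> R.
    by rewrite -[in RHS]intrM; congr (_%:~R); ring.
  exact: h.
have Lall v : low v -> exists2 b, b != 0 & L (b * j) v.
  move=> lv; have [vw0|vw0] := eqVneq (om v w0) 0; last exact: Lspread.
  have lvv : low (v + v1) by apply: lowD.
  have [|b b0 Lb] := Lspread _ lvv; first by rewrite omDl vw0 add0r.
  have [b' b'0 Lb'] := Lspread _ lv1 v1w0.
  exists (b * b'); first by rewrite mulf_neq0.
  have h1 : L (b * b' * j) (v + v1) by rewrite [b * _]mulrC -mulrA; apply: Lmul.
  have h2 : L (b * b' * j) (-1 *: v1) by apply: LZ => //; rewrite -mulrA; apply: Lmul.
  have lN : low (-1 *: v1) by apply: lowZ.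
  by have := LD _ _ _ lvv lN h1 h2; rewrite scaleN1r addrK.
have /choice [b bP] (z : 'I_n) : exists b, b != 0 /\ L (b * j) (low_part (delta_mx z 0)).
  by have [b b0 Lb] := Lall _ (low_low_part (delta_mx z 0)); exists b.
pose m := \prod_z b z * j.
have Lm v : low v -> L m v.
  move=> lv; have -> : v = \sum_z v z 0 *: low_part (delta_mx z 0).
    apply/colP => x; rewrite summxE (bigD1 x) //= big1 => [|y yx].
      rewrite !mxE !eqxx addr0 /=; case: ltnP => [_|/lv ->]; by rewrite ?mulr1 ?mulr0.
    by rewrite !mxE eq_sym (negbTE yx) /= if_same mulr0.
  have : L m (\sum_z v z 0 *: low_part (delta_mx z 0)) /\
         low (\sum_z v z 0 *: low_part (delta_mx z 0)).
    apply: (big_ind (fun x => L m x /\ low x)) => [|x y [Lx lx] [Ly ly]|z _].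
    - by split; [rewrite /L map_mx0 elC el0|move=> z _; rewrite mxE].
    - by split; [apply: LD|apply: lowD].
    - have lz := low_low_part (delta_mx z 0 : 'cV[int]_n); split; last exact: lowZ.
      apply: LZ => //; rewrite /m (bigD1 z) //= mulrAC mulrC; apply: Lmul => //.
      by case: (bP z).
  by case.
have m0 : m != 0.
  by rewrite mulf_neq0 //; apply/prodf_neq0 => z _; case: (bP z).
exists (m * m); first by rewrite lt_def mulf_neq0 // -expr2 sqr_ge0.
split; last by move=> v lv; apply: Lmul => //; apply: Lm.
have -> : (m * m)%:~R = (m * \prod_z b z)%:~R * j%:~R :> R.
  by rewrite -rmorphM /m; congr (_%:~R); ring.
exact: tv_multiple.
Qed.

(** Moving the vector [u] of [root_element] by the root elements [v q] of
    another one yields vectors with rational directions; they involve the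
    pairing of [q] with the plane component of [u]. *)
Lemma pairing_rational (q : 'cV[R]_n) (m : int) (c : R) (f : 'cV[int]_n) p (i : 'I_n) :
  high q -> 0 < m -> (forall v : 'cV[int]_n, low v -> G (el (zv v) (m%:~R *: q))) ->
  tvec (c *: zv f + p) -> 0 < c -> low f -> high p -> is_rat (c ^+ 2) ->
  (i < k)%N -> f i 0 != 0 -> is_rat (om q (c *: p)).
Proof.
move=> hq m0 Gq Xu c0 lf hp c2 ik fi.
pose j := partner i; have jk : (j < k)%N.
  by rewrite /j /=; case: ifP; case: i ik {fi j} => i /= _; lia.
have ij : (i == j) = false.
  by apply/negbTE; rewrite -val_eqE /=; case: ifP; case: i {ik fi j jk} => i /= _; lia.
have lv : low (delta_mx j 0 : 'cV[int]_n) by apply: low_delta.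
have Xx := tvec_act (Gq _ lv) Xu; set x := _ *m _ in Xx.
have xE (l : 'I_n) : (l < k)%N ->
    x l 0 = c * (f l 0)%:~R + m%:~R * om q p * (l == j)%:R.
  move=> lk; rewrite /x elE !omE [om q (zv f)]om_anti om_low_high ?oppr0 ?mulr0 ?add0r //.
    by rewrite !mxE hp // hq // !(mulr0, addr0) andbT; case: (l == j); rewrite ?mulr1 ?mulr0.
  exact: low_zv.
have cn : c != 0 by apply: lt0r_neq0.
have mn : m%:~R != 0 :> R by rewrite intr_eq0 gt_eqF.
have fn : (f i 0)%:~R != 0 :> R by rewrite intr_eq0.
have xi : x i 0 != 0 by rewrite xE // ij mulr0 addr0 mulf_neq0.
have := tvec_ratio Xx ik jk xi; rewrite !xE // ij eqxx mulr0 addr0 mulr1 => h.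
have -> : om q (c *: p) = c ^+ 2 * (((c * (f j 0)%:~R + m%:~R * om q p) / (c * (f i 0)%:~R)
    - (f j 0)%:~R / (f i 0)%:~R) * ((f i 0)%:~R / m%:~R)).
  by rewrite omZr; field; rewrite cn fn mn.
apply: is_ratM => //; apply: is_ratM; last by apply: is_ratM; [|apply: is_ratV]; apply: is_rat_int.
by apply: is_ratB => //; apply: is_ratM; [|apply: is_ratV]; apply: is_rat_int.
Qed.

End CornerVectors.

(** * Divisibility, and the plane orthogonal to the corner *)

Section Gcd.

(** Take for [t] the part of [d] prime to [b' = b / gcd b x]: a prime of [d]
    divides exactly one of [b'] and [x t / gcd b x]. *)
Lemma gcd_shift (d b x : int) : d != 0 ->
  exists t : int, forall e : int, (e %| d)%Z -> (e %| b + x * t)%Z ->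
    (e %| b)%Z /\ (e %| x)%Z.
Proof.
move=> d0; have [->|b0] := eqVneq b 0.
  by exists 1 => e _; rewrite mulr1 add0r dvdz0.
pose c := gcdz b x; have c0 : c != 0 by rewrite gcdz_eq0 (negbTE b0).
have [b' bE] : exists b', b = b' * c by apply/dvdzP/dvdz_gcdl.
have [x' xE] : exists x', x = x' * c by apply/dvdzP/dvdz_gcdr.
have b'0 : b' != 0 by apply: contraNneq b0 => b'0; rewrite bE b'0 mul0r.
have [u [v uv]] := Bezoutz b x.
have cop : u * b' + v * x' = 1.
  by apply: (mulIf c0); rewrite mul1r -[RHS]uv [in RHS]bE [in RHS]xE; ring.
pose pi : nat_pred := negn \pi(absz b'); pose t := partn `|d| pi.
have d0' : (0 < `|d|)%N by rewrite absz_gt0.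
exists t%:Z => e ed.
have copd : coprimez d (b' + x' * t%:Z).
  rewrite /coprimez /gcdz; apply/negPn/negP => g1.
  set G := gcdn _ _ in g1.
  have G0 : (0 < G)%N by rewrite gcdn_gt0 d0'.
  pose p := pdiv G.
  have pp : prime p by apply: pdiv_prime; rewrite ltn_neqAle eq_sym G0 andbT.
  have pG : (p %| G)%N := pdiv_dvd G.
  have pd : (p %| `|d|)%N := dvdn_trans pG (dvdn_gcdl _ _).
  have pb : (p%:Z %| b' + x' * t%:Z)%Z := dvdn_trans pG (dvdn_gcdr _ _).
  have [pb'|pb'] := boolP (p%:Z %| b')%Z.
    have : (p%:Z %| x' * t%:Z)%Z.
      have -> : x' * t%:Z = b' + x' * t%:Z - b' by rewrite addrAC subrr add0r.
      exact: rpredB.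
    rewrite dvdzE abszM Euclid_dvdM // => /orP[px|pt].
      have : (p%:Z %| 1%R)%Z by rewrite -cop; apply: rpredD; apply: dvdz_mull.
      by rewrite dvdzE dvdn1 => /eqP p1; move: pp; rewrite [p]p1.
    have := elimT (pnatP pi (part_gt0 pi _)) (part_pnat pi `|d|) p pp pt.
    by rewrite dvdzE in pb'; rewrite inE /= mem_primes pp absz_gt0 b'0 /= pb'.
  have pt : (p %| t)%N.
    have ppi : pi.-nat p.
      by rewrite dvdzE in pb'; rewrite pnatE // inE /= mem_primes pp absz_gt0 b'0.
    by rewrite -(part_pnat_id ppi); apply: partn_dvd.
  case/negP: pb'; have -> : b' = b' + x' * t%:Z - x' * t%:Z by rewrite addrK.
  by apply: rpredB => //; apply: dvdz_mull.
have -> : b + x * t%:Z = (b' + x' * t%:Z) * c by rewrite {1}bE {1}xE; ring.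
have cope : coprimez e (b' + x' * t%:Z).
  by apply: coprime_dvdl copd.
rewrite Gauss_dvdzr // => ec; split.
  exact: dvdz_trans ec (dvdz_gcdl _ _).
exact: dvdz_trans ec (dvdz_gcdr _ _).
Qed.

Lemma vector_gcd n (b : 'I_n -> int) :
  exists d : int, exists2 r : 'I_n -> int, d = \sum_i r i * b i & forall i, (d %| b i)%Z.
Proof.
elim: n b => [|n ih] b.
  by exists 0; exists (fun=> 0) => [|[]//]; rewrite big_ord0.
have [d [r dE dvd_d]] := ih (fun i => b (lift ord0 i)).
have [u [v uv]] := Bezoutz (b ord0) d.
exists (gcdz (b ord0) d), (fun i => if unlift ord0 i is Some j then v * r j else u).
  rewrite -uv big_ord_recl unlift_none; congr (_ + _).
  by rewrite dE mulr_sumr; apply: eq_bigr => i _; rewrite liftK mulrA.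
move=> i; case: (unliftP ord0 i) => [j|] ->; last exact: dvdz_gcdl.
exact: dvdz_trans (dvdz_gcdr _ _) (dvd_d j).
Qed.

End Gcd.

Section Plane.
Variables (K : numDomainType) (g : nat).
Local Notation n := (2 * g)%N.
Local Notation k := (2 * (g - 1))%N.
Variables i1 i2 : 'I_n.
Hypothesis i1E : i1 = k :> nat.
Hypothesis i2E : i2 = k.+1 :> nat.

Local Notation e1 := (delta_mx i1 0 : 'cV[K]_n).
Local Notation e2 := (delta_mx i2 0 : 'cV[K]_n).

Lemma high_e1 : high e1.
Proof. by move=> i ik; rewrite mxE andbT; case: eqP => // ii; move: ik; rewrite ii i1E ltnn. Qed.
Lemma high_e2 : high e2.
Proof. by move=> i ik; rewrite mxE andbT; case: eqP => // ii; move: ik; rewrite ii i2E ltnNge leqnSn. Qed.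

Lemma om_e1e2 : om e1 e2 = 1.
Proof.
rewrite om_delta symp_form_partner ifT; last by rewrite -val_eqE /= i1E i2E; case: ifP => //; lia.
by have -> : odd i1 = false by rewrite i1E; lia.
Qed.

Lemma om_e2e1 : om e2 e1 = -1.
Proof. by rewrite om_anti om_e1e2. Qed.

Lemma low_high_split (x : 'cV[K]_n) : x = low_part x + x i1 0 *: e1 + x i2 0 *: e2.
Proof.
have i21 : (i2 == i1) = false by apply/negbTE; rewrite -val_eqE /= i1E i2E; lia.
apply/colP => i; rewrite !mxE !andbT; case: ltnP => ik.
  have -> : (i == i1) = false by apply/negbTE; rewrite -val_eqE /= i1E; lia.
  have -> : (i == i2) = false by apply/negbTE; rewrite -val_eqE /= i2E; lia.
  by rewrite !mulr0 !addr0.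
have [->|ii1] := eqVneq i i1; first by rewrite eq_sym i21 mulr0 mulr1 addr0 add0r.
have -> : i = i2.
  by apply: val_inj; move: ii1; rewrite -val_eqE /= i1E i2E; case: i ik => i /=; lia.
by rewrite eqxx mulr0 mulr1 !add0r.
Qed.

End Plane.

(** * The corner embedding *)

Section CornerEmbedding.

Lemma castmxM (K : pzRingType) m n (e : m = n) (A B : 'M[K]_m) :
  castmx (e, e) (A *m B) = castmx (e, e) A *m castmx (e, e) B.
Proof. by case: n / e. Qed.

Lemma castmxT (K : Type) m n (e : m = n) (A : 'M[K]_m) :
  (castmx (e, e) A)^T = castmx (e, e) A^T.
Proof. by case: n / e. Qed.

Lemma castmx1 (K : pzRingType) m n (e : m = n) : castmx (e, e) 1%:M = 1%:M :> 'M[K]_n.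
Proof. by case: n / e. Qed.

Lemma castmxMl (K : pzRingType) m n p (e : m = n) (A : 'M[K]_m) (x : 'M_(m, p)) :
  castmx (e, e) A *m castmx (e, erefl) x = castmx (e, erefl) (A *m x).
Proof. by case: n / e. Qed.

Variables (K : numDomainType) (l g : nat) (lg : (l <= g)%N).
Local Notation e := (sp_embed_dim lg).

Definition pad (x : 'cV[K]_(2 * l)) : 'cV[K]_(2 * g) :=
  castmx (e, erefl) (col_mx x 0).

Definition symp_form_rest : 'M[K]_(2 * g - 2 * l) :=
  drsubmx (castmx (esym e, esym e) (symp_form K g)).

Lemma symp_form_block :
  symp_form K g = castmx (e, e) (block_mx (symp_form K l) 0 0 symp_form_rest).
Proof.
apply: (canRL (castmxKV e e)); rewrite -[LHS]submxK -/symp_form_rest.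
by congr block_mx; apply/matrixP => i j; rewrite !mxE !castmxE !mxE //= ifF //;
  apply/eqP; case: i j => i hi [j hj] /=; lia.
Qed.

Lemma sp_embedM (A B : 'M[K]_(2 * l)) :
  sp_embed lg (A *m B) = sp_embed lg A *m sp_embed lg B.
Proof.
by rewrite /sp_embed -castmxM mulmx_block !(mulmx0, mul0mx, addr0, add0r, mulmx1).
Qed.

Lemma sp_embed1 : sp_embed lg 1%:M = 1%:M :> 'M[K]_(2 * g).
Proof. by rewrite /sp_embed -scalar_mx_block castmx1. Qed.

Lemma sp_embed_pad A x : sp_embed lg A *m pad x = pad (A *m x).
Proof.
by rewrite /sp_embed /pad castmxMl mul_block_col !mul0mx !mulmx0 !addr0.
Qed.

Lemma Sp_embed A : Sp K g (sp_embed lg A) <-> Sp K l A.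
Proof.
rewrite /Sp /= symp_form_block /sp_embed castmxT -!castmxM tr_block_mx !mulmx_block.
rewrite !(mulmx0, mul0mx, addr0, add0r, mulmx1, trmx0, trmx1, mul1mx).
split=> [h|-> //].
by have /eq_block_mx[] := can_inj (castmxK e e) h.
Qed.

Lemma castmx_rank1 m n (ee : m = n) (x : 'cV[K]_m) (B : 'M[K]_m) :
  castmx (ee, ee) (x *m (x^T *m B)) =
  castmx (ee, erefl) x *m ((castmx (ee, erefl) x)^T *m castmx (ee, ee) B).
Proof. by case: n / ee. Qed.

Lemma castmxD m n (ee : m = n) (A B : 'M[K]_m) :
  castmx (ee, ee) (A + B) = castmx (ee, ee) A + castmx (ee, ee) B.
Proof. by case: n / ee. Qed.

Lemma castmxZ m n (ee : m = n) a (A : 'M[K]_m) :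
  castmx (ee, ee) (a *: A) = a *: castmx (ee, ee) A.
Proof. by case: n / ee. Qed.

Lemma sp_embed_tv s x : sp_embed lg (tv s x) = tv s (pad x).
Proof.
rewrite /tv /pad symp_form_block -castmx_rank1 -castmxZ -(castmx1 K e) -castmxD.
rewrite /sp_embed tr_col_mx mul_row_block mul_col_row trmx0.
rewrite !(mulmx0, mul0mx, addr0, add0r) scale_block_mx scalar_mx_block add_block_mx.
by rewrite !scaler0 !addr0.
Qed.

Lemma pad_usubmx (x : 'cV[K]_(2 * g)) : (forall i : 'I_(2 * g), (2 * l <= i)%N -> x i 0 = 0) ->
  x = pad (usubmx (castmx (esym e, erefl) x)).
Proof.
move=> hx; apply: (canRL (castmxKV _ _)).
rewrite -[LHS]vsubmxK; congr col_mx.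
apply/colP => i; rewrite !mxE castmxE /= -[RHS](hx (cast_ord e (rshift (2 * l) i))) /=.
  by congr (x _ _); apply: val_inj.
by rewrite leq_addr.
Qed.

(** An element fixing the last coordinate vectors preserves their orthogonal. *)
Lemma Sp_fix_high A : Sp K g A ->
  (forall i : 'I_(2 * g), (2 * l <= i)%N -> A *m delta_mx i 0 = delta_mx i 0 :> 'cV_(2 * g)) ->
  exists B, A = sp_embed lg B.
Proof.
move=> /Sp_om hA fixA; exists (ulsubmx (castmx (esym e, esym e) A)).
have AE (i j : 'I_(2 * g)) : (2 * l <= j)%N -> A i j = (i == j)%:R.
  by move=> /fixA; rewrite -colE => /colP/(_ i); rewrite !mxE andbT.
have fix_high (x : 'cV[K]_(2 * g)) : (forall i : 'I__, (i < 2 * l)%N -> x i 0 = 0) -> A *m x = x.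
  move=> hx; apply/colP => i; rewrite mxE (bigD1 i) //= big1 => [|j ji].
    rewrite addr0; have [/hx ->|li] := ltnP i (2 * l); first by rewrite mulr0.
    by rewrite AE // eqxx mul1r.
  have [/hx ->|lj] := ltnP j (2 * l); first by rewrite mulr0.
  by rewrite AE // eq_sym (negbTE ji) mul0r.
have AE' (i j : 'I_(2 * g)) : (2 * l <= i)%N -> A i j = (i == j)%:R.
  move=> li; have -> : A i j = om (A *m delta_mx j 0) (dual_basis i).
    by rewrite om_dual_basis -colE mxE.
  rewrite -[dual_basis i]fix_high ?hA ?om_dual_basis ?mxE ?andbT //.
  move=> x xl; rewrite /dual_basis mxE -colE !mxE ifF ?oppr0 //; apply/eqP; lia.
apply: (canRL (castmxKV e e)); rewrite -[LHS]submxK; congr block_mx.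
- apply/matrixP => i j; rewrite !mxE castmxE AE ?leq_addr //=.
  by apply/eqP; rewrite -val_eqE /= pnatr_eq0 eqb0; case: i j => i hi [j hj] /=; lia.
- apply/matrixP => i j; rewrite !mxE castmxE AE' ?leq_addr //=.
  by apply/eqP; rewrite -val_eqE /= pnatr_eq0 eqb0; case: i j => i hi [j hj] /=; lia.
- apply/matrixP => i j; rewrite !mxE castmxE AE ?leq_addr //=.
  by rewrite -val_eqE /= eqn_add2l.
Qed.

End CornerEmbedding.

(** * Reduction of integral symplectic matrices to the corner *)

Section Reduction.
Variables (g : nat) (g_ge3 : (3 <= g)%N).
Local Notation n := (2 * g)%N.
Local Notation k := (2 * (g - 1))%N.
Variables i1 i2 : 'I_n.
Hypothesis i1E : i1 = k :> nat.
Hypothesis i2E : i2 = k.+1 :> nat.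
Local Notation e1 := (delta_mx i1 0 : 'cV[int]_n).
Local Notation e2 := (delta_mx i2 0 : 'cV[int]_n).

Variables (m : int) (m_gt1 : 1 < m).
Variable G : set 'M[int]_n.
Hypothesis G_mul : forall A B, G A -> G B -> G (A *m B).
Hypothesis G_el1 : forall v, low v -> G (el v (m *: e1)).
Hypothesis G_el2 : forall v, low v -> G (el v (m *: e2)).
Hypothesis G_tv1 : forall a, G (tv (a * m) e1).
Hypothesis G_tv2 : forall a, G (tv (a * m) e2).

(** The congruence condition keeps track of the fact that [m] divides the
    coordinates to be cleared once [e1] has been reached. *)
Definition level_one (A : 'M[int]_n) := [/\ G A, Sp int g A & exists B, A = 1%:M + m *: B].

Lemma level_oneM A B : level_one A -> level_one B -> level_one (A *m B).
Proof.
move=> [GA SA [A' AE]] [GB SB [B' BE]]; split; [exact: G_mul|exact: SpM|].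
exists (A' + B' + m *: (A' *m B')).
rewrite {1}AE {1}BE mulmxDl !mulmxDr !mul1mx mulmx1 -scalemxAl -scalemxAr !scalerDr.
by rewrite -!addrA; congr (_ + _); rewrite addrCA.
Qed.

Lemma om_low_e1 v : low v -> om v e1 = 0.
Proof. by move=> lv; apply: om_low_high => //; apply: high_e1 i1E. Qed.
Lemma om_low_e2 v : low v -> om v e2 = 0.
Proof. by move=> lv; apply: om_low_high => //; apply: high_e2 i2E. Qed.
Lemma om_e1_low v : low v -> om e1 v = 0.
Proof. by move=> lv; rewrite om_anti om_low_e1 ?oppr0. Qed.
Lemma om_e2_low v : low v -> om e2 v = 0.
Proof. by move=> lv; rewrite om_anti om_low_e2 ?oppr0. Qed.

Lemma level_one_el v e : om v e = 0 -> G (el v (m *: e)) -> level_one (el v (m *: e)).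
Proof.
move=> ve Gve; split=> //; first by apply: el_Sp; rewrite omZr ve mulr0.
exists (v *m (e^T *m symp_form int g) + e *m (v^T *m symp_form int g)).
by rewrite /el linearZ /= -!scalemxAl -scalemxAr scalerDr addrA.
Qed.

Lemma level_one_tv a e : G (tv (a * m) e) -> level_one (tv (a * m) e).
Proof.
move=> Ge; split=> //; first exact: tv_Sp.
by exists (a *: (e *m (e^T *m symp_form int g))); rewrite /tv scalerA mulrC.
Qed.

Definition reach (x y : 'cV[int]_n) := exists2 A, level_one A & A *m x = y.

Lemma reach_trans y x z : reach x y -> reach y z -> reach x z.
Proof.
move=> [A lA <-] [B lB <-]; exists (B *m A); first exact: level_oneM.
by rewrite mulmxA.
Qed.

Definition vec (b : 'cV[int]_n) (x y : int) := m *: b + x *: e1 + y *: e2.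

Lemma dvd_vec (e : int) (b : 'cV[int]_n) x y i : (e %| x)%Z -> (e %| y)%Z ->
  (forall i, (e %| b i 0%R)%Z) -> (e %| vec b x y i 0%R)%Z.
Proof.
move=> ex ey eb; rewrite /vec !mxE; apply: rpredD; last exact: dvdz_mulr.
by apply: rpredD; [apply: dvdz_mull|apply: dvdz_mulr].
Qed.

Lemma reach_el1 b v x y : low b -> low v ->
  reach (vec b x y) (vec (b + y *: v) (x + m ^+ 2 * om v b) y).
Proof.
move=> lb lv; exists (el v (m *: e1)).
  by apply: level_one_el; [apply: om_low_e1|apply: G_el1].
rewrite elE /vec !omE (om_low_e1 lv) (om_low_e2 lv) (om_e1_low lb) (om_e1e2 _ i1E i2E).
by apply/colP => i; rewrite !mxE; ring.
Qed.

Lemma reach_el2 b v x y : low b -> low v ->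
  reach (vec b x y) (vec (b - x *: v) x (y + m ^+ 2 * om v b)).
Proof.
move=> lb lv; exists (el v (m *: e2)).
  by apply: level_one_el; [apply: om_low_e2|apply: G_el2].
rewrite elE /vec !omE (om_low_e1 lv) (om_low_e2 lv) (om_e2_low lb) (om_e2e1 _ i1E i2E).
by apply/colP => i; rewrite !mxE; ring.
Qed.

Lemma reach_tv2 b a x y : low b -> reach (vec b x y) (vec b x (y - a * m * x)).
Proof.
move=> lb; exists (tv (a * m) e2); first by apply: level_one_tv.
rewrite tvE /vec !omE (om_e2_low lb) (om_e2e1 _ i1E i2E).
by apply/colP => i; rewrite !mxE; ring.
Qed.

Lemma low_add_scale a (v b : 'cV[int]_n) : low b -> low v -> low (b + a *: v).
Proof. by move=> lb lv; rewrite addrC; apply: low_comb. Qed.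

(** A vector with a nonzero coordinate outside position [j]: the gcd [d] of
    the coordinates outside [j] stays fixed while the [j]-th one is changed by
    multiples of [x], then of [y], until it is prime to [d]. *)
Lemma reach_primitive (b : 'cV[int]_n) (x y : int) (j l : 'I_n) :
  low b -> (j < k)%N -> l != j -> b l 0 != 0 ->
  (forall e : int, (e %| x)%Z -> (e %| y)%Z -> (forall i, (e %| b i 0%R)%Z) -> (e %| 1%R)%Z) ->
  exists b' v : 'cV[int]_n, exists x' y' : int,
    [/\ low b', low v, om v b' = 1, (m ^+ 2 %| x' - x)%Z & (m ^+ 2 %| y' - y)%Z /\
        reach (vec b x y) (vec b' x' y')].
Proof.
move=> lb jk lj bl prim.
pose ej : 'cV[int]_n := delta_mx j 0.
have lej : low ej by apply: low_delta.
have ejE i : ej i 0 = (i == j)%:R by rewrite mxE andbT.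
have [d [r dE dvd_d]] := vector_gcd (fun i => if i == j then 0 else b i 0).
have dvd_b i : i != j -> (d %| b i 0%R)%Z by move=> ij; have := dvd_d i; rewrite (negbTE ij).
have d0 : d != 0 by apply: contraNneq bl => d0; have := dvd_b _ lj; rewrite d0 dvd0z.
have [t ht] := gcd_shift (b j 0) x d0.
pose b1 := b - x *: (- t *: ej); pose y1 := y + m ^+ 2 * om (- t *: ej) b.
have lb1 : low b1 by rewrite /b1 -scaleNr; apply: low_add_scale => //; apply: lowZ.
have b1E i : b1 i 0 = b i 0 + x * t * (i == j)%:R by rewrite !mxE andbT; ring.
have d_om : (d %| om ej b)%Z.
  rewrite om_sum; apply: rpred_sum => i _; have [->|ij] := eqVneq i j.
    rewrite big1 => [|i' _]; first by rewrite mul0r rpred0.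
    rewrite ejE; case: eqP => [->|_]; last by rewrite mul0r.
    by rewrite mxE eqxx ltnn subrr mulr0.
  by apply: dvdz_mull; apply: dvd_b.
have [t' ht'] := gcd_shift (b1 j 0) y1 d0.
pose b2 := b1 + y1 *: (t' *: ej); pose x2 := x + m ^+ 2 * om (t' *: ej) b1.
have lb2 : low b2 by apply: low_add_scale => //; apply: lowZ.
have b2E i : b2 i 0 = b1 i 0 + y1 * t' * (i == j)%:R by rewrite !mxE andbT; ring.
have cop e : (e %| d)%Z -> (e %| b2 j 0%R)%Z -> (e %| 1%R)%Z.
  rewrite b2E eqxx mulr1 => ed /(ht' _ ed)[]; rewrite b1E eqxx mulr1 => /(ht _ ed)[ebj ex] ey1.
  apply: prim => // [|i].
    have -> : y = y1 - m ^+ 2 * om (- t *: ej) b by rewrite /y1 addrK.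
    apply: rpredB => //; rewrite omZl; do 2!apply: dvdz_mull; exact: dvdz_trans ed d_om.
  by have [->//|ij] := eqVneq i j; apply: dvdz_trans ed (dvd_b _ ij).
have [u [w uw]] := Bezoutz d (b2 j 0).
pose c := gcdz d (b2 j 0); rewrite -/c in uw.
have c1 : (c %| 1%R)%Z by apply: cop; [apply: dvdz_gcdl|apply: dvdz_gcdr].
have {c1} c1 : c = 1.
  by move: c1; rewrite dvdzE dvdn1 => /eqP c1; rewrite -[LHS]gez0_abs // /c c1.
pose z : 'cV[int]_n := - (u *: \sum_(i | (i != j) && (i < k)%N) r i *: dual_basis i + w *: dual_basis j).
have lz : low z.
  rewrite /z -scaleN1r; apply: lowZ; apply: low_comb; last by apply: lowZ; apply: low_dual_basis.
  elim/big_rec : _ => [i _|i v /andP[_ ik] lv]; first by rewrite mxE.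
  by apply: low_comb => //; apply: low_dual_basis.
exists b2, z, x2, y1; split=> //.
- rewrite om_anti /z omNr opprK omDr !omZr om_dual_basis -c1 -uw; congr (u * _ + _).
  have -> : om b2 (\sum_(i | (i != j) && (i < k)%N) r i *: dual_basis i) =
            \sum_(i | (i != j) && (i < k)%N) r i * b2 i 0.
    elim/big_rec2 : _ => [|i s v _ <-]; first by rewrite om0r.
    by rewrite omDr omZr om_dual_basis.
  rewrite dE [RHS](bigID (fun i : 'I_n => (i != j) && (i < k)%N)) /= [X in _ = _ + X]big1 ?addr0 => [|i].
    by apply: eq_bigr => i /andP[/negbTE ij ik]; rewrite b2E b1E ij !mulr0 !addr0.
  by rewrite negb_and negbK -leqNgt; case: eqP => //= _; rewrite ?mulr0 // => /lb ->; rewrite mulr0.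
- by rewrite /x2 addrAC subrr add0r dvdz_mulr.
- split; first by rewrite /y1 addrAC subrr add0r dvdz_mulr.
  by apply: (reach_trans (reach_el2 _ _ _ _)); [| |apply: reach_el1] => //; apply: lowZ.
Qed.

(** Once the corner part is primitive, pairing with it changes [x] by arbitrary
    multiples of [m^2], so [x] becomes [1]; then [b] and [y] are cleared. *)
Lemma reach_e1 (b : 'cV[int]_n) (x y : int) :
  low b -> (m ^+ 2 %| x - 1%R)%Z -> (m ^+ 2 %| y)%Z ->
  (forall e : int, (e %| x)%Z -> (e %| y)%Z -> (forall i, (e %| b i 0%R)%Z) -> (e %| 1%R)%Z) ->
  reach (vec b x y) e1.
Proof.
move=> lb x1 y0 prim.
have h0 : (0 < n)%N by lia.
have h1 : (1 < n)%N by lia.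
pose j := Ordinal h0; pose l := Ordinal h1.
have jk : (j < k)%N by rewrite /=; lia.
have lk : (l < k)%N by rewrite /=; lia.
have lj : l != j by [].
have m0 : m != 0 by apply: lt0r_neq0; apply: lt_trans m_gt1.
have m20 : m ^+ 2 != 0 by rewrite expf_neq0.
have x0 : x != 0.
  apply: contraTneq x1 => ->; rewrite sub0r dvdzE abszN absz1 dvdn1 abszX.
  by rewrite -[1%N](exp1n 2) eqn_exp2r // gtn_eqF //; move: m_gt1; clear; lia.
wlog bl : b y lb y0 prim / b l 0 != 0 => [wl|].
  have [bl|] := eqVneq (b l 0) 0; last exact: wl.
  pose el' : 'cV[int]_n := delta_mx l 0.
  have lel : low (-1 *: el') by apply: lowZ; apply: low_delta.
  apply: (reach_trans (reach_el2 x y lb lel)).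
  have b'E i : (b - x *: (-1 *: el')) i 0 = b i 0 + x * (i == l)%:R.
    by rewrite !mxE andbT; ring.
  apply: wl => [||e ex ey eb|].
  - by rewrite -scaleNr; apply: low_add_scale.
  - by apply: rpredD => //; apply: dvdz_mulr.
  - have ebi i : (e %| b i 0%R)%Z.
      have -> : b i 0 = (b - x *: (-1 *: el')) i 0 - x * (i == l)%:R by rewrite b'E addrK.
      by apply: rpredB => //; apply: dvdz_mulr.
    apply: prim => //.
    have -> : y = y + m ^+ 2 * om (-1 *: el') b - m ^+ 2 * om (-1 *: el') b by rewrite addrK.
    apply: rpredB => //; apply: dvdz_mull; rewrite om_sum; apply: rpred_sum => i _.
    exact: dvdz_mull.
  - by rewrite b'E bl eqxx mulr1 add0r.
(* The element [v] with [om v b' = 1] first turns [x'] into [1]; the element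
   [b3] then clears the corner part without changing [y']. *)
have [b' [v [x' [y' [lb' lv vb' x'x [y'y]]]]]] := reach_primitive lb jk lj bl prim.
move/reach_trans; apply.
have /dvdzP[s sE] : (m ^+ 2 %| x' - 1%R)%Z.
  have -> : x' - 1 = (x' - x) + (x - 1) by rewrite addrA subrK.
  exact: rpredD.
have /dvdzP[r rE] : (m ^+ 2 %| y')%Z.
  have -> : y' = (y' - y) + y by rewrite subrK.
  exact: rpredD.
apply: (reach_trans (reach_el1 x' y' lb' (lowZ (- s) lv))).
set b3 := b' + _; have lb3 : low b3 by apply: low_add_scale => //; apply: lowZ.
have -> : x' + m ^+ 2 * om (- s *: v) b' = 1.
  have -> : x' = 1 + s * m ^+ 2 by rewrite -sE addrC subrK.
  by rewrite omZl vb'; ring.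
apply: (reach_trans (reach_el2 1 y' lb3 lb3)).
rewrite scale1r subrr omxx mulr0 addr0.
have l0 : low (0 : 'cV[int]_n) by move=> i _; rewrite mxE.
have := reach_tv2 (r * m) 1 y' l0.
by rewrite mulr1 -mulrA -expr2 -rE subrr /vec scaler0 scale0r scale1r add0r addr0.
Qed.

Local Notation gle := (leq_subr 1 g).

(** A matrix congruent to [1] modulo [m^2] becomes an element of the corner
    after moving its image of [e1] back to [e1], then that of [e2] to [e2]. *)
Lemma congruence_factor (h : 'M[int]_n) : Sp int g h ->
  (exists B, h = 1%:M + m ^+ 2 *: B) ->
  exists2 A, G A & exists2 s, Sp int (g - 1) s & A *m h = sp_embed gle s.
Proof.
move=> Sh [B hB].
pose z := h *m e1; pose z' := B *m e1.
have zE : z = vec (m *: low_part z') (1 + m ^+ 2 * z' i1 0) (m ^+ 2 * z' i2 0).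
  rewrite /z hB mulmxDl mul1mx -scalemxAl -/z'.
  rewrite {1}(low_high_split i1E i2E z') /vec.
  by apply/colP => i; rewrite !mxE; ring.
have [] := @reach_e1 (m *: low_part z') (1 + m ^+ 2 * z' i1 0) (m ^+ 2 * z' i2 0).
- exact/lowZ/low_low_part.
- by rewrite addrC addrA (addrC (-1)) subrr add0r dvdz_mulr.
- exact: dvdz_mulr.
- move=> e ex ey eb.
  have ez i : (e %| z i 0%R)%Z by rewrite zE; apply: dvd_vec.
  have : (invmx h *m z) i1 0 = 1.
    by rewrite /z mulKmx ?Sp_unit // mxE !eqxx.
  by move<-; rewrite mxE; apply: rpred_sum => i _; apply: dvdz_mull.
rewrite -zE => A1 [G1 S1 [B1 A1E]] A1z.
pose h1 := A1 *m h.
have Sh1 : Sp int g h1 by apply: SpM.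
have h1e1 : h1 *m e1 = e1 by rewrite -mulmxA.
have [B2 h1E] : exists B2, h1 = 1%:M + m *: B2.
  exists (B1 *m h + m *: B).
  rewrite /h1 A1E mulmxDl mul1mx -scalemxAl {1}hB scalerDr scalerA -expr2.
  by rewrite -addrA; congr (_ + _); rewrite addrC.
pose u := B2 *m e2; pose w := low_part u.
have lw : low w by apply: low_low_part.
have omu : om e1 u = u i2 0.
  rewrite {1}(low_high_split i1E i2E u) !omDr !omZr (om_e1_low lw) omxx.
  by rewrite (om_e1e2 _ i1E i2E) mulr0 mulr1 !add0r.
have ui2 : u i2 0 = 0.
  have /Sp_om/(_ e1 e2) := Sh1; rewrite h1e1 h1E mulmxDl mul1mx -scalemxAl -/u.
  rewrite omDr omZr omu => /eqP; rewrite -subr_eq0 addrAC subrr add0r mulf_eq0.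
  by rewrite gt_eqF ?(lt_trans _ m_gt1) //= => /eqP.
have h1e2 : h1 *m e2 = e2 + m *: (w + u i1 0 *: e1).
  rewrite h1E mulmxDl mul1mx -scalemxAl -/u {1}(low_high_split i1E i2E u) ui2.
  by rewrite scale0r addr0.
pose A2 := tv (- u i1 0 * m) e1 *m el (- w) (m *: e1).
have lNw : low (- w) by rewrite -scaleN1r; apply: lowZ.
have GA2 : G A2 by apply: G_mul => //; apply: G_el1.
have SA2 : Sp int g A2.
  by apply: SpM; [apply: tv_Sp|apply: el_Sp; rewrite omZr om_low_e1 ?mulr0].
have A2e1 : A2 *m e1 = e1.
  rewrite -mulmxA elE !omE (om_low_e1 lw) !(mulr0, oppr0, scale0r, addr0).
  by rewrite tvE omxx mulr0 scale0r addr0.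
have A2e2 : A2 *m (h1 *m e2) = e2.
  rewrite h1e2 -mulmxA elE tvE !omE (om_low_e1 lw) (om_low_e2 lw) (om_e1_low lw).
  rewrite (om_e1e2 _ i1E i2E); by apply/colP => i; rewrite !mxE; ring.
exists (A2 *m A1); first exact: G_mul.
have Sh2 : Sp int g (A2 *m h1) by apply: SpM.
have [i li|s hs] := Sp_fix_high gle Sh2.
  have [->|ii1] := eqVneq i i1; first by rewrite -mulmxA h1e1.
  have -> : i = i2.
    by apply: val_inj; move: ii1; rewrite -val_eqE /= i1E i2E; case: i li => i /=; lia.
  by rewrite -mulmxA.
exists s; last by rewrite -mulmxA.
by apply/(Sp_embed gle); rewrite -hs.
Qed.

End Reduction.

(** * Finite index *)

Section FiniteIndex.
Variables (R : comUnitRingType) (n : nat).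
Implicit Types G H : set 'M[R]_n.

Lemma finite_index_reps H G : H 1%:M -> finite_index H G ->
  exists S : seq 'M[R]_n, forall A, G A ->
    exists2 s, s \in S & G s /\ exists2 h, H h & A = s *m h.
Proof.
move=> H1 [_ /finite_seqP[X XE]].
pose coset A : set 'M[R]_n := [set A *m B | B in H].
pose rep (Y : set 'M[R]_n) := xget 1%:M [set s | G s /\ coset s = Y].
exists [seq rep Y | Y <- X] => A GA.
have AX : coset A \in X by have : [set` X] (coset A) by rewrite -XE; exists A.
have [Gs sA] : G (rep (coset A)) /\ coset (rep (coset A)) = coset A.
  rewrite /rep; case: xgetP => [s _ //|].
  by move=> /(_ A) h; case: h.
exists (rep (coset A)); first exact: map_f.
split=> //.
have : coset (rep (coset A)) A by rewrite sA; exists 1%:M => //; rewrite mulmx1.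
by case=> h Hh hA; exists h.
Qed.

Lemma finite_index_cover H G (S : seq 'M[R]_n) : mx_subgroup H -> H `<=` G ->
  (forall A, G A -> exists2 s, s \in S & exists2 h, H h & A = s *m h) ->
  finite_index H G.
Proof.
move=> [Hu H1 HM HV] HG cov; split=> //.
apply: (@sub_finite_set _ _ [set [set s *m B | B in H] | s in [set` S]]); last first.
  by apply: finite_image; apply: finite_seq.
move=> _ [A GA <-]; have [s sS [h Hh ->]] := cov A GA.
exists s => //; apply/seteqP; split=> [_ [B HB <-]|_ [B HB <-]].
  exists (invmx h *m B); first by apply: HM => //; apply: HV.
  by rewrite -mulmxA mulKVmx //; apply: Hu.
by exists (h *m B); [exact: HM|rewrite mulmxA].
Qed.

Lemma finite_index_invariant (T : finType) (phi : 'M[R]_n -> T) H G :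
  mx_subgroup H -> H `<=` G -> G `<=` [set A | A \in unitmx] ->
  (forall A B, G A -> G B -> phi A = phi B -> H (invmx A *m B)) ->
  finite_index H G.
Proof.
move=> Hsub HG Gu phiH.
pose rep t := xget 1%:M [set s | G s /\ phi s = t].
apply: (@finite_index_cover _ _ [seq rep t | t <- enum T]) => // A GA.
have [Gs sA] : G (rep (phi A)) /\ phi (rep (phi A)) = phi A.
  rewrite /rep; case: xgetP => [s _ //|].
  by move=> /(_ A) h; case: h.
exists (rep (phi A)); first by apply: map_f; rewrite mem_enum.
exists (invmx (rep (phi A)) *m A); first exact: phiH.
by rewrite mulKVmx //; apply: Gu.
Qed.

Lemma finite_index_conj (C : 'M[R]_n) H G : C \in unitmx ->
  finite_index H G -> finite_index (mx_conj C H) (mx_conj C G).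
Proof.
move=> Cu [HG fin]; split.
  by move=> _ [A HA <-]; exists A => //; apply: HG.
apply: (sub_finite_set _ (finite_image (mx_conj C) fin)).
move=> _ [_ [A GA <-] <-]; exists [set A *m B | B in H]; first by exists A.
have conjM B : C *m A *m invmx C *m (C *m B *m invmx C) = C *m (A *m B) *m invmx C.
  by rewrite !mulmxA mulmxKV.
apply/seteqP; split=> [_ [_ [B HB <-] <-]|_ [_ [B HB <-] <-]].
  by exists (C *m B *m invmx C); rewrite ?conjM //; exists B.
by rewrite conjM; exists (A *m B) => //; exists B.
Qed.

Lemma mx_conj_setI (C : 'M[R]_n) G H : C \in unitmx ->
  mx_conj C (G `&` H) = mx_conj C G `&` mx_conj C H.
Proof.
move=> Cu; apply/seteqP; split=> [_ [A [GA HA] <-]|_ [[A GA <-] [B HB]]].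
  by split; exists A.
have CVu : invmx C \in unitmx by rewrite unitmx_inv.
move=> /(can_inj (mulmxK CVu))/(can_inj (mulKmx Cu)) BA; exists A => //; split=> //.
by rewrite -BA.
Qed.

Lemma mx_conjK (C : 'M[R]_n) G : C \in unitmx -> mx_conj C (mx_conj (invmx C) G) = G.
Proof.
move=> Cu; have conjK A : C *m (invmx C *m A *m invmx (invmx C)) *m invmx C = A.
  by rewrite invmxK !mulmxA mulmxV // mul1mx mulmxK.
apply/seteqP; split=> [_ [_ [A GA <-] <-]|A GA]; first by rewrite conjK.
by exists (invmx C *m A *m invmx (invmx C)) => //; exists A.
Qed.

End FiniteIndex.

Section Residues.
Variable n : nat.

Definition residues (b : nat) (d : nat) (A : 'M[int]_n) : {ffun 'I_n * 'I_n -> 'I_b.+1} :=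
  [ffun p => inord `|(A p.1 p.2 %% d)%Z|%N].

Lemma residues_eq b d (A B : 'M[int]_n) : (0 < d <= b.+1)%N ->
  residues b d A = residues b d B -> exists X, B = A + d%:Z *: X.
Proof.
case/andP=> d0 db /ffunP AB.
have dz : d%:Z != 0 by rewrite eqz_nat -lt0n.
have mod_bound (a : int) : (`|(a %% d)%Z| < b.+1)%N.
  apply: leq_trans db; rewrite -ltz_nat gez0_abs ?modz_ge0 //.
  by have := ltz_mod a dz; rewrite ger0_norm.
have dvd i j : (d%:Z %| B i j - A i j)%Z.
  have := AB (i, j); rewrite !ffunE /= => /(congr1 val) /=.
  rewrite !inordK // => h; rewrite -eqz_mod_dvd; apply/eqP.
  by rewrite -[LHS]gez0_abs ?modz_ge0 // -h gez0_abs ?modz_ge0.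
exists (\matrix_(i, j) ((B i j - A i j) %/ d)%Z).
apply/matrixP => i j; rewrite !mxE -[LHS](subrK (A i j)) addrC; congr (_ + _).
by rewrite mulrC divzK.
Qed.

End Residues.

Section Transvections.
Variables (R : realType) (g : nat).
Local Notation n := (2 * g)%N.

Lemma SpZ_zv (A : 'M[int]_n) : Sp int g A -> SpZ R g (zv A).
Proof. by exists A. Qed.

Lemma SpZ_Sp : SpZ R g `<=` Sp R g.
Proof. by move=> _ [A hA <-]; apply/Sp_zv. Qed.

Lemma SpZ_subgroup : mx_subgroup (SpZ R g).
Proof.
split=> [A /SpZ_Sp/Sp_unit //||_ _ [A hA <-] [B hB <-]|_ [A hA <-]].
- by exists 1%:M; [apply: Sp1|rewrite map_mx1].
- by exists (A *m B); [apply: SpM|rewrite map_mxM].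
- by exists (invmx A); [apply: SpV|rewrite invmx_zv].
Qed.

Lemma subgroupI (G H : set 'M[R]_n) : mx_subgroup G -> mx_subgroup H -> mx_subgroup (G `&` H).
Proof.
move=> [Gu G1 GM GV] [_ H1 HM HV]; split=> //.
- by move=> A [/Gu].
- by move=> A B [GA HA] [GB HB]; split; [apply: GM|apply: HM].
- by move=> A [GA HA]; split; [apply: GV|apply: HV].
Qed.

(** Among the first powers of a transvection two lie in the same coset; the
    exponent of the quotient is bounded by the index, so a factorial works for
    all transvections at once. *)
Lemma finite_index_tv (H : set 'M[R]_n) : mx_subgroup H -> finite_index H (SpZ R g) ->
  exists2 N : nat, (0 < N)%N & forall v : 'cV[int]_n, H (tv N%:R (zv v)).
Proof.
move=> [Hu H1 HM HV] fin; have [S Scov] := finite_index_reps H1 fin.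
exists (size S)`!; first exact: fact_gt0.
move=> v; pose t (a : nat) : 'M[R]_n := tv a%:R (zv v).
have tD a b : t (a + b)%N = t a *m t b by rewrite /t tvD natrD.
have cov a : exists s, s \in S /\ exists2 h, H h & t a = s *m h.
  have [|s sS [_ hs]] := Scov (t a); last by exists s.
  exists (tv a%:Z v); first exact: tv_Sp.
  by rewrite zv_tv -pmulrn.
have [f fP] := choice cov.
pose F (a : 'I_(size S).+1) : 'I_(size S) := Ordinal (etrans (index_mem (f a) S) (proj1 (fP a))).
have /injectivePn[a [b ab Fab]] : ~~ injectiveb F.
  by apply/negP => /injectiveP/leq_card; rewrite !card_ord ltnn.
have {Fab} fab : f a = f b.
  by move: Fab => /(congr1 val) /= /(congr1 (nth 1%:M S)); rewrite !nth_index //; case: (fP a) (fP b) => + _ [].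
wlog ltab : a b ab fab / (a < b)%N.
  move=> wl; have [h|h|/val_inj h] := ltngtP a b; last by rewrite h eqxx in ab.
    exact: (wl a b).
  by apply: (wl b a) => //; rewrite eq_sym.
have [_ [ha Ha ta]] := fP a; have [_ [hb Hb tb]] := fP b.
have Ht : H (t (b - a)%N).
  have sa : t (b - a)%N = invmx ha *m hb.
    have tau : t a \in unitmx by apply: Sp_unit; apply: tv_Sp.
    apply: (can_inj (mulKmx tau)); rewrite -tD subnKC ?(ltnW ltab) // tb -fab.
    by rewrite {1}ta -mulmxA mulKVmx //; apply: Hu.
  by rewrite sa; apply: HM => //; apply: HV.
have Hmul c : H (t (c * (b - a))%N).
  elim: c => [|c ih]; first by rewrite mul0n /t tv0.
  by rewrite mulSn tD; apply: HM.
have /dvdnP[c ->] : (b - a %| (size S)`!)%N; last exact: Hmul.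
by apply: dvdn_fact; rewrite subn_gt0 ltab /=; apply: leq_trans (leq_subr _ _) _; rewrite -ltnS.
Qed.

End Transvections.

(** * Integrality up to a bounded multiplier *)

Section Integrality.
Variables (R : realType) (g : nat).
Local Notation n := (2 * g)%N.
Variable G : set 'M[R]_n.
Hypothesis G_subgroup : mx_subgroup G.
Hypothesis G_Sp : G `<=` Sp R g.
Hypothesis G_gap : forall s u v, 0 < s -> G (tv s u) -> G (tv s v) ->
  om u v = 0 \/ 1 <= s * `|om u v|.
Variable M : nat.
Hypothesis M_gt0 : (0 < M)%N.
Hypothesis G_tv : forall v : 'cV[int]_n, G (tv M%:R (zv v)).
Hypothesis g_gt0 : (0 < g)%N.

(** The bilinear form [om (A v) w] on integral vectors has a gap at [0].  Let
    [x0] be one of its values, nearly smallest; it generates the values in each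
    row and column through the pair where it is attained, and moving that pair
    shows that it generates all values. *)
Lemma scaled_integral A : G A -> exists c : R, exists X : 'M[int]_n,
  [/\ 0 < c, M%:R^-1 <= c & A = c *: zv X].
Proof.
move=> GA; have MR : 0 < M%:R :> R by rewrite ltr0n.
pose B (v w : 'cV[int]_n) := om (A *m zv v) (zv w).
have Bl w (a : int) x y : B (a *: x + y) w = a%:~R * B x w + B y w.
  by rewrite /B map_mxD zvZ mulmxDr -scalemxAr !omE.
have Br v (a : int) x y : B v (a *: x + y) = a%:~R * B v x + B v y.
  by rewrite /B map_mxD zvZ !omE.
have gap v w : B v w = 0 \/ M%:R^-1 <= `|B v w|.
  have Xv := tvec_act G_subgroup G_Sp GA (G_tv v).
  case: (G_gap MR Xv (G_tv w)) => [h|h]; first by left.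
  by right; rewrite -[_^-1]mul1r ler_pdivrMr // mulrC.
have Bentry (i j : 'I_n) : B (delta_mx j 0) (dual_basis i) = A i j.
  rewrite /B map_delta_mx.
  by rewrite zv_dual_basis om_dual_basis -colE mxE.
have B0r v : B v 0 = 0 by rewrite /B map_mx0 om0r.
have BNr v w : B v (- w) = - B v w by rewrite /B map_mxN omNr.
pose E := [set x | exists v w, x = B v w].
have [x0 [[v0 [w0 x0E]] x00 [c' cc' [x0c' minE]]]] : exists x0, [/\ E x0, 0 < x0 &
  exists2 c', M%:R^-1 <= c' & x0 < 2 * c' /\ forall x, E x -> 0 < x -> c' <= x].
  apply: gap_min => [x [v [w ->]]||]; [exact: gap|by rewrite invr_gt0|].
  have n0 : (0 < n)%N by rewrite muln_gt0.
  pose z := Ordinal n0.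
  have [w Bw] : exists w, B (delta_mx z 0) w != 0.
    apply: contrapT => h.
    have A0 (i : 'I_n) : A i z = 0.
      by apply: contrapT => /eqP Az; apply: h; exists (dual_basis i); rewrite Bentry.
    have := mulVmx (Sp_unit (G_Sp GA)) => /matrixP/(_ z z).
    rewrite !mxE eqxx big1 => [/eqP|i _]; first by rewrite eq_sym oner_eq0.
    by rewrite A0 mulr0.
  have [h|h] := ltP 0 (B (delta_mx z 0) w).
    by exists (B (delta_mx z 0) w) => //; exists (delta_mx z 0), w.
  exists (- B (delta_mx z 0) w); last by rewrite oppr_gt0 lt_def eq_sym Bw.
  by exists (delta_mx z 0), (- w); rewrite BNr.
have gap' v w : B v w = 0 \/ c' <= `|B v w|.
  have [h|h|->] := ltgtP 0 (B v w); last by left.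
    by right; rewrite gtr0_norm // minE //; exists v, w.
  right; rewrite ltr0_norm // minE ?oppr_gt0 //.
  by exists v, (- w); rewrite BNr.
have row v w1 : B v w1 = x0 -> forall w, exists a : int, B v w = a%:~R * x0.
  move=> vx w; have := @gap_cyclic _ _ (B v) c' w1 (Br v) (gap' v).
  by rewrite vx => /(_ x00 x0c' w).
have col w1 v1 : B v1 w1 = x0 -> forall v, exists a : int, B v w1 = a%:~R * x0.
  move=> vx v; have := @gap_cyclic _ _ (B^~ w1) c' v1 (Bl w1) (gap'^~ w1).
  by rewrite /= vx => /(_ x00 x0c' v).
have all v w : exists a : int, B v w = a%:~R * x0.
  have [a aE] := col _ _ (esym x0E) v.
  have [b bE] := row _ _ (esym x0E) w.
  pose v3 := (- a) *: v0 + (v + v0).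
  have v3E w' : B v3 w' = - a%:~R * B v0 w' + (B v w' + B v0 w').
    by rewrite /v3 Bl -[v]scale1r Bl mul1r scale1r rmorphN.
  have v3w0 : B v3 w0 = x0 by rewrite v3E aE -x0E; ring.
  have [q qE] := row _ _ v3w0 w.
  exists (q + a * b - b); rewrite rmorphB rmorphD rmorphM /=.
  have -> : B v w = B v3 w + a%:~R * B v0 w - B v0 w by rewrite v3E; ring.
  by rewrite qE bE; ring.
have [X XE] := choice (fun p : 'I_n * 'I_n => all (delta_mx p.2 0) (dual_basis p.1)).
exists x0, (\matrix_(i, j) X (i, j)); split=> //.
- by apply: (le_trans cc'); apply: minE => //; exists v0, w0.
- by apply/matrixP => i j; rewrite !mxE mulrC -XE Bentry.
Qed.

(** [c^2] times an entry of the integral matrix [X^T J X] is an entry [1] of the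
    form. *)
Lemma multiplier A (c : R) (X : 'M[int]_n) : Sp R g A -> 0 < c -> M%:R^-1 <= c ->
  A = c *: zv X -> exists2 d : nat, (0 < d <= M ^ 2)%N & d%:R * c ^+ 2 = 1.
Proof.
move=> SA c0 cM AE; have MR : 0 < M%:R :> R by rewrite ltr0n.
have n0 : (0 < n)%N by rewrite muln_gt0.
have n1 : (1 < n)%N by move: g_gt0; clear; lia.
pose z0 := Ordinal n0; pose z1 := Ordinal n1.
have : om (A *m delta_mx z0 0) (A *m delta_mx z1 0) = 1.
  by have /Sp_om -> := SA; rewrite om_delta mxE /= subr0.
have zd (z : 'I_n) : delta_mx z 0 = zv (delta_mx z 0) :> 'cV[R]_n by rewrite map_delta_mx.
rewrite AE -!scalemxAl !zd -!map_mxM !omE om_zv mulrA -expr2.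
set D := om _ _ => cD.
have c2 : 0 < c ^+ 2 by rewrite exprn_gt0.
have D0 : 0 < D.
  by rewrite -(ltr_int R) -(pmulr_rgt0 _ c2) cD.
have DE : D = `|D|%N by rewrite gez0_abs // ltW.
exists `|D|%N; last by rewrite pmulrn -DE mulrC.
rewrite absz_gt0 (gt_eqF D0) /= -(ler_nat R) natrX pmulrn -DE -(ler_pM2l c2) cD.
rewrite -exprMn -[leLHS](expr1n _ 2) lerXn2r ?nnegrE ?ler01 //.
  by rewrite mulr_ge0 // ltW.
by rewrite -ler_pdivrMr // mul1r.
Qed.

(** [A = c X] with [X] integral and [d = c^-2] a bounded integer; the coset of
    [A] only depends on [d] and on [X] modulo [d]. *)
Lemma finite_index_integral : finite_index (G `&` SpZ R g) G.
Proof.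
have dat A : exists p : nat * 'M[int]_n, G A ->
    (0 < p.1 <= M ^ 2)%N /\ exists c : R, [/\ 0 < c, p.1%:R * c ^+ 2 = 1 & A = c *: zv p.2].
  have [GA|] := pselect (G A); last by exists (0%N, 0).
  have [c [X [c0 cM AE]]] := scaled_integral GA.
  have [d dM dc] := multiplier (G_Sp GA) c0 cM AE.
  by exists (d, X) => _; split=> //; exists c.
have [f fP] := choice dat.
pose T := ('I_(M ^ 2).+1 * {ffun 'I_n * 'I_n -> 'I_(M ^ 2).+1})%type.
pose phi A : T := (inord (f A).1, residues (M ^ 2) (f A).1 (f A).2).
apply: (@finite_index_invariant _ _ T phi).
- by apply: subgroupI => //; apply: SpZ_subgroup.
- by move=> A [].
- by move=> A /G_Sp/Sp_unit.
move=> A B GA GB [].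
have [/andP[dA0 dAM] [a [a0 da AE]]] := fP A GA.
have [/andP[dB0 dBM] [b [b0 db BE]]] := fP B GB.
move=> /(congr1 val) /=; rewrite !inordK // => dd.
rewrite -dd in db * => res; have [|X XE] := residues_eq _ res.
  by rewrite dA0 leqW.
set X0 := (f A).2 in AE XE; set d := (f A).1 in dA0 dAM da dd db res XE *.
have dR : d%:R != 0 :> R by rewrite pnatr_eq0 -lt0n.
have ab : a = b.
  apply/eqP; rewrite -(@eqrXn2 _ 2) ?ltW //; apply/eqP.
  by apply: (mulfI dR); rewrite da db.
have SA := G_Sp GA; have SB := G_Sp GB.
have [_ _ GM GV] := G_subgroup.
have ABE : invmx A *m B = zv (1%:M - symp_form int g *m X0^T *m symp_form int g *m X).
  have -> : B = A + (a * d%:R) *: zv X.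
    by rewrite BE XE -ab map_mxD zvZ scalerDr scalerA -pmulrn -AE.
  rewrite mulmxDr mulVmx ?Sp_unit // -scalemxAr Sp_invmx //.
  rewrite /sp_inv AE map_mxB map_mx1 !map_mxM !symp_form_int -map_trmx.
  rewrite linearZ /= -scalemxAr -!scalemxAl mulNmx scalerN -!scalemxAl scalerA.
  have -> : a * d%:R * a = 1 by rewrite -[RHS]da; ring.
  by rewrite scale1r.
have GAB : G (invmx A *m B) by apply: GM => //; apply: GV.
split=> //; move: (G_Sp GAB); rewrite ABE => /Sp_zv; exact: SpZ_zv.
Qed.

End Integrality.

(** * The index in the integral group *)

Section CornerIndex.
Variables (R : realType) (g : nat) (g_ge3 : (3 <= g)%N).
Local Notation n := (2 * g)%N.
Local Notation k := (2 * (g - 1))%N.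
Local Notation gle := (leq_subr 1 g).
Variables i1 i2 : 'I_n.
Hypothesis i1E : i1 = k :> nat.
Hypothesis i2E : i2 = k.+1 :> nat.
Local Notation e1 := (delta_mx i1 0 : 'cV[R]_n).
Local Notation e2 := (delta_mx i2 0 : 'cV[R]_n).

Lemma zv_sp_embed (A : 'M[int]_k) : zv (sp_embed gle A) = sp_embed gle (zv A) :> 'M[R]_n.
Proof. by rewrite /sp_embed map_castmx map_block_mx !map_mx0 map_mx1. Qed.

Variable G : set 'M[R]_n.
Hypothesis G_subgroup : mx_subgroup G.
Hypothesis G_Sp : G `<=` Sp R g.
Variables (m : int) (m_gt1 : 1 < m).
Hypothesis G_el1 : forall v : 'cV[int]_n, low v -> G (el (zv v) (m%:~R *: e1)).
Hypothesis G_el2 : forall v : 'cV[int]_n, low v -> G (el (zv v) (m%:~R *: e2)).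
Hypothesis G_tv1 : G (tv m%:~R e1).
Hypothesis G_tv2 : G (tv m%:~R e2).
Variable Delta : set 'M[R]_k.
Hypothesis Delta_subgroup : mx_subgroup Delta.
Hypothesis Delta_index : finite_index Delta (SpZ R (g - 1)).
Hypothesis Delta_G : [set sp_embed gle M | M in Delta] `<=` G.

(** Modulo [m^2] there are finitely many classes, and [congruence_factor] writes
    an element of the principal one as an element of the corner times one of [G];
    the corner is covered by finitely many cosets of [Delta]. *)
Lemma finite_index_corner : finite_index (G `&` SpZ R g) (SpZ R g).
Proof.
have [Gu G1 GM GV] := G_subgroup.
have [Du D1 DM DV] := Delta_subgroup.
have [S Scov] := finite_index_reps D1 Delta_index.
have zed (i : 'I_n) (a : int) : a%:~R *: delta_mx i 0 = zv (a *: delta_mx i 0) :> 'cV[R]_n.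
  by rewrite zvZ map_delta_mx.
have zd (i : 'I_n) : delta_mx i 0 = zv (delta_mx i 0) :> 'cV[R]_n by rewrite map_delta_mx.
pose GZ : set 'M[int]_n := [set A | G (zv A)].
have factor (h : 'M[int]_n) : Sp int g h -> (exists B, h = 1%:M + m ^+ 2 *: B) ->
    exists2 A, GZ A & exists2 s, Sp int (g - 1) s & A *m h = sp_embed gle s.
  apply: (congruence_factor g_ge3 i1E i2E m_gt1).
  - by move=> A B; rewrite /GZ /= map_mxM; apply: GM.
  - by move=> v lv; rewrite /GZ /= zv_el -zed; apply: G_el1.
  - by move=> v lv; rewrite /GZ /= zv_el -zed; apply: G_el2.
  - by move=> a; rewrite /GZ /= zv_tv -zd rmorphM; apply: (tv_multiple G_subgroup).
  - by move=> a; rewrite /GZ /= zv_tv -zd rmorphM; apply: (tv_multiple G_subgroup).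
pose d := (`|m| ^ 2)%N.
have d0 : (0 < d)%N by rewrite expn_gt0 absz_gt0 gt_eqF // (lt_trans _ m_gt1).
have dE : d%:Z = m ^+ 2 by rewrite /d -abszX gez0_abs // sqr_ge0.
pose rep t : 'M[int]_n := xget 1%:M [set A | Sp int g A /\ residues d d A = t].
have sub : mx_subgroup (G `&` SpZ R g) by apply: subgroupI => //; apply: SpZ_subgroup.
have [_ _ IM IV] := sub.
apply: (@finite_index_cover _ _ _ _
  [seq zv (rep t) *m sp_embed gle s | t <- enum {ffun 'I_n * 'I_n -> 'I_d.+1}, s <- S]) => //.
move=> _ [A SA <-].
have [Sr rA] : Sp int g (rep (residues d d A)) /\
    residues d d (rep (residues d d A)) = residues d d A.
  rewrite /rep; case: xgetP => [s _ //|].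
  by move=> /(_ A) h; case: h.
set a := rep _ in Sr rA.
have [|X AE] := residues_eq _ rA; first by rewrite d0 leqW.
pose h := invmx a *m A.
have Sh : Sp int g h by apply: SpM => //; apply: SpV.
have hE : h = 1%:M + m ^+ 2 *: (invmx a *m X).
  by rewrite /h AE mulmxDr mulVmx ?Sp_unit // -scalemxAr dE.
have hVE : invmx h = 1%:M + m ^+ 2 *: (- (invmx h *m (invmx a *m X))).
  apply/eqP; rewrite scalerN eq_sym subr_eq; apply/eqP.
  by rewrite -[LHS](mulVmx (Sp_unit Sh)) {2}hE mulmxDr mulmx1 -scalemxAr.
have [|Y GY [s Ss Ys]] := factor (invmx h) (SpV Sh); first by exists (- (invmx h *m (invmx a *m X))).
have hY : h = sp_embed gle (invmx s) *m Y.
  have Shu := Sp_unit Sh.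
  apply: (can_inj (mulmxK (_ : invmx h \in unitmx))); first by rewrite unitmx_inv.
  by rewrite mulmxV // -mulmxA Ys -sp_embedM mulVmx ?sp_embed1 // Sp_unit.
have [s' s'S [Ss' [del Dd sE]]] := Scov (zv (invmx s)) (SpZ_zv R (SpV Ss)).
exists (zv a *m sp_embed gle s').
  by apply/allpairsP; exists (residues d d A, s'); rewrite mem_enum.
have AaY : zv A = zv a *m sp_embed gle s' *m (sp_embed gle del *m zv Y) :> 'M[R]_n.
  have -> : A = a *m h by rewrite /h mulKVmx // Sp_unit.
  rewrite hY !map_mxM zv_sp_embed sE sp_embedM.
  by rewrite !mulmxA.
exists (sp_embed gle del *m zv Y) => //.
have Sas : SpZ R g (zv a *m sp_embed gle s').
  have [_ _ ZM _] := SpZ_subgroup R g; apply: ZM; first exact: SpZ_zv.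
  case: Ss' => s0 Ss0 <-; rewrite -zv_sp_embed; apply: SpZ_zv.
  by apply/Sp_embed.
split; first by apply: GM => //; apply: Delta_G; exists del.
have -> : sp_embed gle del *m zv Y = invmx (zv a *m sp_embed gle s') *m zv A.
  by rewrite AaY mulKmx //; apply/Sp_unit/SpZ_Sp.
have [_ _ ZM ZV] := SpZ_subgroup R g.
by apply: ZM; [apply: ZV|apply: SpZ_zv].
Qed.

End CornerIndex.

(** * Frames of the orthogonal plane *)

Section PlaneFrame.
Variables (R : realType) (g : nat).
Local Notation n := (2 * g)%N.
Local Notation k := (2 * (g - 1))%N.
Local Notation gle := (leq_subr 1 g).
Variables i1 i2 : 'I_n.
Hypothesis i1E : i1 = k :> nat.
Hypothesis i2E : i2 = k.+1 :> nat.
Local Notation e1 := (delta_mx i1 0 : 'cV[R]_n).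
Local Notation e2 := (delta_mx i2 0 : 'cV[R]_n).

Lemma high_split (p : 'cV[R]_n) : high p -> p = p i1 0 *: e1 + p i2 0 *: e2.
Proof.
move=> hp; rewrite {1}(low_high_split i1E i2E p).
have -> : low_part p = 0.
  by apply/colP => i; rewrite !mxE; case: ltnP => // /hp.
by rewrite add0r.
Qed.

Lemma om_high (p q : 'cV[R]_n) : high p -> high q ->
  om p q = p i1 0 * q i2 0 - p i2 0 * q i1 0.
Proof.
move=> hp hq; rewrite {1}(high_split hp) {1}(high_split hq) !omE.
by rewrite (om_e1e2 _ i1E i2E) (om_e2e1 _ i1E i2E); ring.
Qed.

Definition frame_mx (p q : 'cV[R]_n) : 'M[R]_n :=
  \matrix_(i, j) (if j == i1 then p i 0 else if j == i2 then q i 0 else (i == j)%:R).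

Lemma frame_mx_low p q x : low x -> frame_mx p q *m x = x.
Proof.
move=> lx; apply/colP => i; rewrite mxE.
rewrite (eq_bigr (fun j => (i == j)%:R * x j 0)) => [|j _].
  rewrite (bigD1 i) //= big1 => [|j ji]; first by rewrite eqxx mul1r addr0.
  by rewrite eq_sym (negbTE ji) mul0r.
rewrite mxE; have [->|_] := eqVneq j i1; first by rewrite lx ?i1E // !mulr0.
by have [->|_] := eqVneq j i2; first by rewrite lx ?i2E ?leqnSn // !mulr0.
Qed.

Lemma frame_mx_e1 p q : frame_mx p q *m e1 = p.
Proof. by rewrite -colE; apply/colP => i; rewrite !mxE eqxx. Qed.

Lemma frame_mx_e2 p q : frame_mx p q *m e2 = q.
Proof.
rewrite -colE; apply/colP => i; rewrite !mxE eqxx.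
by rewrite (_ : (i2 == i1) = false) //; apply/negbTE; rewrite -val_eqE /= i1E i2E; lia.
Qed.

Lemma frame_mx_Sp p q : high p -> high q -> om p q = 1 -> Sp R g (frame_mx p q).
Proof.
move=> hp hq pq; apply/Sp_om => x y.
have E z : frame_mx p q *m z = low_part z + z i1 0 *: p + z i2 0 *: q.
  rewrite {1}(low_high_split i1E i2E z) !mulmxDr -!scalemxAr frame_mx_e1 frame_mx_e2.
  by rewrite frame_mx_low //; apply: low_low_part.
rewrite !E [in RHS](low_high_split i1E i2E x) [in RHS](low_high_split i1E i2E y) !omE.
have lp (z r : 'cV[R]_n) : high r -> om (low_part z) r = 0.
  by move=> hr; apply: om_low_high => //; apply: low_low_part.
have pl (z r : 'cV[R]_n) : high r -> om r (low_part z) = 0.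
  by move=> hr; rewrite om_anti lp ?oppr0.
have he1 : high e1 := high_e1 _ i1E.
have he2 : high e2 := high_e2 _ i2E.
rewrite !(lp _ _ hp, lp _ _ hq, pl _ _ hp, pl _ _ hq, lp _ _ he1, lp _ _ he2, pl _ _ he1, pl _ _ he2).
by rewrite [om q p]om_anti pq (om_e1e2 _ i1E i2E) (om_e2e1 _ i1E i2E).
Qed.

Lemma sp_embed_high (A : 'M[R]_k) x : high x -> sp_embed gle A *m x = x.
Proof.
move=> hx; have -> : x = castmx (sp_embed_dim gle, erefl)
    (col_mx 0 (dsubmx (castmx (esym (sp_embed_dim gle), erefl) x))).
  apply: (canRL (castmxKV _ _)); rewrite -[LHS]vsubmxK; congr col_mx.
  apply/colP => i; rewrite !mxE castmxE /=.
  rewrite -[RHS](hx (cast_ord (sp_embed_dim gle) (lshift (2 * g - k) i))) //=.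
  by congr (x _ _); apply: val_inj.
by rewrite /sp_embed castmxMl mul_block_col !mul0mx !mulmx0 mul1mx !add0r.
Qed.

Lemma frame_mx_sp_embed p q (A : 'M[R]_k) : high p -> high q ->
  frame_mx p q *m sp_embed gle A = sp_embed gle A *m frame_mx p q.
Proof.
move=> hp hq; apply: mx_act_inj => x; rewrite -!mulmxA.
rewrite (low_high_split i1E i2E x) !mulmxDr -!scalemxAr.
rewrite !(sp_embed_high _ (high_e1 _ i1E)) !(sp_embed_high _ (high_e2 _ i2E)).
rewrite !frame_mx_e1 !frame_mx_e2 !(sp_embed_high _ hp) !(sp_embed_high _ hq) (@pad_usubmx _ _ _ gle _ (low_low_part x)).
rewrite sp_embed_pad.
have lpad y : low (pad gle y : 'cV[R]_n).
  by move=> i ki; rewrite /pad castmxE mxE; case: splitP => j /= ij; [move: ki; rewrite ij; case: j {ij} => j /=; lia|rewrite mxE].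
by rewrite !frame_mx_low // sp_embed_pad.
Qed.

(** The condition is the non-vanishing of a polynomial, and it holds for the root
    element of [Sp] that maps the basis vector [i0] to its sum with
    [s e1 + t e2]. *)
Lemma dense_vector (G : set 'M[R]_n) (s t : R) (i0 : 'I_n) : (i0 < k)%N ->
  zariski_dense_in G (Sp R g) -> s != 0 \/ t != 0 ->
  exists2 A, G A & A i0 i0 != 0 /\ s * A i1 i0 + t * A i2 i0 != 0.
Proof.
move=> i0k [_ dense] st; apply: contrapT => none.
pose X (i j : 'I_n) := mpolyX R (mnm1 (mxvec_index i j)).
pose P := X i0 i0 * (s *: X i1 i0 + t *: X i2 i0).
have PE A : meval (fun l => mxvec A 0 l) P = A i0 i0 * (s * A i1 i0 + t * A i2 i0).
  by rewrite mevalM mevalD !mevalZ !mevalXU !mxvecE.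
pose p : 'cV[R]_n := s *: e1 + t *: e2; pose v : 'cV[R]_n := - dual_basis i0.
have hp : high p.
  by apply: highD; apply: highZ; [apply: high_e1|apply: high_e2].
have lv : low v by rewrite /v -scaleN1r; apply: lowZ; apply: low_dual_basis.
have vp : om v p = 0 by apply: om_low_high.
have /(_ P erefl) : mx_zero_locus [set P] (el v p).
  apply: (dense _ (el_Sp vp)); first by exists [set P].
  move=> A GA _ ->; rewrite PE; apply/eqP; rewrite mulf_eq0 -[_ || _]negbK negb_or.
  by apply/negP => /andP[h1 h2]; apply: none; exists A.
have entryE (i : 'I_n) : el v p i i0 = (i == i0)%:R + p i 0.
  have -> : el v p i i0 = (el v p *m (delta_mx i0 0 : 'cV[R]_n)) i 0 by rewrite -colE [RHS]mxE.
  rewrite elE /v omNl [om (dual_basis i0) _]om_anti opprK om_dual_basis.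
  rewrite [om p _]om_anti [om _ p]om_low_high ?oppr0 ?scale0r ?addr0 //; last exact: low_delta.
  by rewrite !mxE !eqxx andbT opprK mul1r.
have i10 : (i1 == i0) = false by apply/negbTE; rewrite -val_eqE /= i1E; lia.
have i20 : (i2 == i0) = false by apply/negbTE; rewrite -val_eqE /= i2E; lia.
have i21 : (i2 == i1) = false by apply/negbTE; rewrite -val_eqE /= i1E i2E; lia.
rewrite PE !entryE eqxx hp // i10 i20 !mxE !eqxx [i1 == i2]eq_sym i21 !mulr0 !mulr1.
rewrite addr0 !add0r addr0 mul1r -!expr2 => /eqP; rewrite paddr_eq0 ?sqr_ge0 // !sqrf_eq0.
by case/andP => /eqP s0 /eqP t0; case: st; rewrite ?s0 ?t0 eqxx.
Qed.

End PlaneFrame.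

(** * Commensurability *)

Section Frame.
Variables (R : realType) (g : nat) (g_ge3 : (3 <= g)%N).
Local Notation n := (2 * g)%N.
Local Notation k := (2 * (g - 1))%N.
Variables i1 i2 : 'I_n.
Hypothesis i1E : i1 = k :> nat.
Hypothesis i2E : i2 = k.+1 :> nat.
Variable G : set 'M[R]_n.
Hypothesis G_subgroup : mx_subgroup G.
Hypothesis G_Sp : G `<=` Sp R g.
Hypothesis G_gap : forall s u v, 0 < s -> G (tv s u) -> G (tv s v) ->
  om u v = 0 \/ 1 <= s * `|om u v|.
Hypothesis G_dense : zariski_dense_in G (Sp R g).
Variable N : nat.
Hypothesis N_gt0 : (0 < N)%N.
Hypothesis G_corner : forall v : 'cV[int]_n, low v -> G (tv N%:R (zv v)).

Definition contains_roots (p : 'cV[R]_n) (x : R) :=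
  G (tv x p) /\ forall v : 'cV[int]_n, low v -> G (el (zv v) (x *: p)).

Lemma contains_roots_mul p (x : R) (a : int) : high p -> contains_roots p x -> contains_roots p (a%:~R * x).
Proof.
move=> hp [Gt Ge]; split=> [|v lv]; first exact: tv_multiple.
rewrite -scalerA -elZ; apply: el_multiple => //; last exact: Ge.
by rewrite omZr om_low_high ?mulr0 //; apply: low_zv.
Qed.

(** Density provides two vectors [u1], [u2] in the orbit of an integral vector of
    the corner whose plane components are independent.  Their multiples [q1],
    [q2] carry root lattices of [G] and have a rational pairing [r], so the
    lattice of [q2] is commensurable to that of [q2 / r], and [q1], [q2 / r] is a
    symplectic basis. *)
Lemma integral_frame : exists p q : 'cV[R]_n, exists m : int,
  [/\ high p, high q, om p q = 1, 1 < m & contains_roots p m%:~R /\ contains_roots q m%:~R].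
Proof.
have n0 : (0 < n)%N by lia.
pose z := Ordinal n0; have zk : (z < k)%N by rewrite /=; lia.
have Xz : tvec G N (delta_mx z 0).
  have -> : delta_mx z 0 = zv (delta_mx z 0) :> 'cV[R]_n by rewrite map_delta_mx.
  by apply: G_corner; apply: low_delta.
have Az_entry (A : 'M[R]_n) i : (A *m (delta_mx z 0 : 'cV_n)) i 0 = A i z.
  by rewrite -colE mxE.
have data A : G A -> A z z != 0 ->
    exists c : R, exists f : 'cV[int]_n, exists p : 'cV[R]_n, exists m : int,
    [/\ 0 < c, low f, high p, A *m delta_mx z 0 = c *: zv f + p &
     [/\ is_rat (c ^+ 2), f z 0 != 0, 0 < m & contains_roots (c *: p) m%:~R]].
  move=> GA Az.
  have XA := tvec_act G_subgroup G_Sp GA Xz.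
  have hz : exists2 i : 'I_n, (i < k)%N & (A *m (delta_mx z 0 : 'cV_n)) i 0 != 0.
    by exists z; rewrite ?Az_entry.
  have [c [f [p [c0 lf hp AE [c2 [w [a [lw w0 a0 Gw]]]]]]]] :=
    root_element G_subgroup G_Sp G_gap N_gt0 G_corner g_ge3 XA hz.
  have [m m0 [Gt Ge]] := root_lattice G_subgroup G_Sp N_gt0 G_corner (highZ c hp) lw w0 a0 Gw.
  exists c, f, p, m; split=> //; split=> //.
  apply: contra Az => /eqP fz; rewrite -Az_entry AE !mxE hp // fz mulr0 addr0.
  exact: eqxx.
have [|A1 GA1 [A1z A1p]] := dense_vector i1E i2E (s := 1) (t := 0) zk G_dense.
  by left; rewrite oner_eq0.
have [c1 [f1 [p1 [m1 [c10 lf1 hp1 A1E [c12 f1z m10 B1]]]]]] := data _ GA1 A1z.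
have p1i : p1 i1 0 != 0.
  apply: contra A1p => /eqP p10; rewrite mul0r addr0 mul1r -Az_entry A1E !mxE p10.
  by rewrite lf1 ?i1E // mulr0 addr0.
have [|A2 GA2 [A2z A2p]] := dense_vector i1E i2E (s := - p1 i2 0) (t := p1 i1 0) zk G_dense.
  by right.
have [c2 [f2 [p2 [m2 [c20 lf2 hp2 A2E [c22 f2z m20 B2]]]]]] := data _ GA2 A2z.
have p12 : om p1 p2 != 0.
  rewrite (om_high i1E i2E) //; apply: contra A2p => /eqP h.
  rewrite -!Az_entry A2E !mxE lf2 ?i1E // [f2 i2 0]lf2 ?i2E ?leqnSn // mulr0 !add0r.
  by rewrite -h mulNr addrC.
pose q1 := c1 *: p1; pose q2 := c2 *: p2.
have hq1 : high q1 by apply: highZ.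
have hq2 : high q2 by apply: highZ.
pose r := om q1 q2.
have r0 : r != 0 by rewrite /r omZl omZr !mulf_neq0 // lt0r_neq0.
have rr : is_rat r.
  case: B1 => _ Ge1.
  apply: (pairing_rational G_subgroup G_Sp G_gap N_gt0 G_corner g_ge3 hq1 m10 Ge1 _ c20 lf2 hp2 c22 zk f2z).
  by rewrite -A2E; apply: tvec_act.
have [a a0 [l alE]] := is_rat_denom rr.
have aR : a%:~R != 0 :> R by rewrite intr_eq0 gt_eqF.
have rE : r = l%:~R / a%:~R by rewrite -alE mulrC mulKf.
have l0 : l != 0.
  by apply: contraNneq r0 => l0; rewrite rE l0 mul0r.
have [q [hq q2E q1q]] : exists q, [/\ high q, q2 = r *: q & om q1 q = 1].
  exists (r^-1 *: q2); split; first exact: highZ.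
    by rewrite scalerA divff // scale1r.
  by rewrite omZr -/r mulVf.
pose m := 2 * m1 * m2 * (a * l) ^+ 2.
have mp : 1 < m.
  have h1 : 1 <= m1 by rewrite -gtz0_ge1.
  have h2 : 1 <= m2 by rewrite -gtz0_ge1.
  have h3 : 1 <= (a * l) ^+ 2.
    by rewrite -gtz0_ge1 exprn_even_gt0 //= mulf_neq0 // gt_eqF.
  have h4 : 1 <= m1 * m2 * (a * l) ^+ 2 by apply: mulr_ege1 => //; apply: mulr_ege1.
  have -> : m = 2 * (m1 * m2 * (a * l) ^+ 2) by rewrite /m !mulrA.
  by apply: (@lt_le_trans _ _ (2 * 1)) => //; rewrite ler_pM2l.
exists q1, q, m; split=> //; split.
  have -> : m%:~R = (2 * m2 * (a * l) ^+ 2)%:~R * m1%:~R :> R.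
    by rewrite -intrM; congr (_%:~R); rewrite /m; ring.
  exact: contains_roots_mul _ hq1 B1.
case: B2 => Gt2 Ge2; rewrite -/q2 in Gt2 Ge2; split.
  have -> : m%:~R = (2 * m1 * a ^+ 2 * a ^+ 2)%:~R * (m2%:~R * r ^+ 2) :> R.
    rewrite /m rE !(intrM, rmorphXn) /=; field.
    exact: aR.
  by apply: tv_multiple => //; rewrite -tvZ -q2E; exact: Gt2.
move=> v lv.
have -> : m%:~R *: q = (2 * m1 * a ^+ 2 * a * l)%:~R *: (m2%:~R *: q2).
  rewrite q2E !scalerA; congr (_ *: _).
  by rewrite /m rE !(intrM, rmorphXn) /=; field; exact: aR.
rewrite -elZ; apply: el_multiple => //; last exact: Ge2.
by rewrite omZr om_low_high ?mulr0 //; apply: low_zv.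
Qed.

End Frame.

Theorem corollary6 (R : realType) (g : nat) (hg : (3 <= g)%N)
    (Gamma : set 'M[R]_(2 * g))
    (Gamma_subgroup : mx_subgroup Gamma)
    (Gamma_Sp : Gamma `<=` Sp R g)
    (Gamma_discrete : discrete_subset Gamma)
    (Gamma_dense : zariski_dense_in Gamma (Sp R g))
    (Gamma_corner : exists Delta : set 'M[R]_(2 * (g - 1)),
        [/\ mx_subgroup Delta,
            finite_index Delta (SpZ R (g - 1))
          & [set sp_embed (leq_subr 1 g) M | M in Delta] `<=` Gamma]) :
  exists2 C : 'M[R]_(2 * g), Sp R g C & commensurable Gamma (mx_conj C (SpZ R g)).
Proof.
have [Delta [Ds Df DG]] := Gamma_corner.
have p1 : (2 * (g - 1) < 2 * g)%N by lia.
have p2 : ((2 * (g - 1)).+1 < 2 * g)%N by lia.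
pose i1 := Ordinal p1; pose i2 := Ordinal p2.
have i1E : i1 = (2 * (g - 1))%N :> nat by [].
have i2E : i2 = (2 * (g - 1)).+1 :> nat by [].
have gap := shimizu Gamma_subgroup Gamma_discrete.
have [N N0 NDelta] := finite_index_tv Ds Df.
have corner (v : 'cV[int]_(2 * g)) : low v -> Gamma (tv N%:R (zv v)).
  move=> lv; rewrite (@pad_usubmx _ _ _ (leq_subr 1 g) _ lv).
  rewrite /pad map_castmx map_col_mx map_mx0 -/(pad _ _) -sp_embed_tv.
  by apply: DG; exists (tv N%:R (zv (usubmx (castmx (esym (sp_embed_dim (leq_subr 1 g)), erefl) v)))).
have [p [q [m [hp hq pq m1 [[Gtp Gep] [Gtq Geq]]]]]] :=
  integral_frame hg i1E i2E Gamma_subgroup Gamma_Sp gap Gamma_dense N0 corner.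
(* From here on [Gamma] is seen in the frame [C], as the group [G]. *)
pose C := frame_mx i1 i2 p q.
have SC : Sp R g C by apply: frame_mx_Sp.
have Cu := Sp_unit SC.
pose G := mx_conj (invmx C) Gamma.
have GE A : G A <-> Gamma (C *m A *m invmx C).
  split=> [[B GB <-]|GA].
    by rewrite invmxK !mulmxA mulmxV // mul1mx mulmxK.
  by exists (C *m A *m invmx C) => //; rewrite invmxK !mulmxA mulVmx // mul1mx mulmxKV.
have [Gu G1 GM GV] := Gamma_subgroup.
have G_Sp : G `<=` Sp R g.
  by move=> _ [A GA <-]; apply: SpM; [apply: SpM; [apply: SpV|apply: Gamma_Sp]|apply/SpV/SpV].
have G_subgroup : mx_subgroup G.
  split=> [A /G_Sp/Sp_unit //||A B /GE GA /GE GB|A GA].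
  - by apply/GE; rewrite mulmx1 mulmxV.
  - apply/GE; have -> : C *m (A *m B) *m invmx C = C *m A *m invmx C *m (C *m B *m invmx C).
      by rewrite !mulmxA mulmxKV.
    exact: GM.
  - have Au := Sp_unit (G_Sp _ GA); apply/GE.
    have -> : C *m invmx A *m invmx C = invmx (C *m A *m invmx C).
      have Bu : C *m A *m invmx C \in unitmx by rewrite !unitmx_mul Cu Au unitmx_inv.
      apply: (can_inj (mulmxK Bu)); rewrite mulVmx //.
      by rewrite !mulmxA mulmxKV // mulmxKV // mulmxV.
    by apply: GV; apply/GE.
have Gtv s u : G (tv s u) <-> Gamma (tv s (C *m u)).
  by rewrite -(conj_tv s u SC); apply: GE.
have G_gap s u v : 0 < s -> G (tv s u) -> G (tv s v) -> om u v = 0 \/ 1 <= s * `|om u v|.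
  move=> s0 /Gtv Gsu /Gtv Gsv; have := gap _ _ _ s0 Gsu Gsv.
  by have /Sp_om -> := SC.
have Gel (v : 'cV[int]_(2 * g)) y : low v -> Gamma (el (zv v) (C *m y)) -> G (el (zv v) y).
  move=> lv Gv; apply/GE; rewrite conj_el // frame_mx_low //.
  exact: low_zv.
have e1E := frame_mx_e1 i1 i2 p q; have e2E := frame_mx_e2 i1E i2E p q.
have fin : finite_index (G `&` SpZ R g) (SpZ R g).
  apply: (@finite_index_corner _ _ hg _ _ i1E i2E _ G_subgroup _ m1 _ _ _ _ Delta) => //.
  - by move=> v lv; apply: Gel => //; rewrite -scalemxAr e1E; apply: Gep.
  - by move=> v lv; apply: Gel => //; rewrite -scalemxAr e2E; apply: Geq.
  - by apply/Gtv; rewrite e1E.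
  - by apply/Gtv; rewrite e2E.
  - move=> _ [A DA <-]; apply/GE; rewrite frame_mx_sp_embed // mulmxK //.
    by apply: DG; exists A.
(* Now [G] contains transvections along all integral vectors. *)
have [M M0 GM'] := finite_index_tv (subgroupI G_subgroup (SpZ_subgroup R g)) fin.
have fin' : finite_index (G `&` SpZ R g) G.
  apply: (finite_index_integral G_subgroup G_Sp G_gap M0) => [v|]; last by lia.
  by case: (GM' v).
exists C => //; split.
  have := finite_index_conj Cu fin'; rewrite mx_conj_setI // mx_conjK //.
have := finite_index_conj Cu fin; rewrite mx_conj_setI // mx_conjK //.
Qed.
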